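(* Let $(\Omega,\mathcal{F})$ be a measurable space, $T:\Omega\to\Omega$ measurable, and $V$ a $T$-invariant upper probability. The following are equivalent: (i) $V$ is weakly mixing with respect to $T$; (ii) for every measurable space $(\Omega',\mathcal{F}')$, measurable $T':\Omega'\to\Omega'$ and $T'$-invariant upper probability $V'$ which is ergodic, the upper probability $V\times V'$ is ergodic with respect to $T\times T'$; (iii) $V\times V$ is ergodic with respect to $T\times T$.
   Context: A capacity is a monotone map $\mu:\mathcal{F}\to[0,1]$ with $\mu(\emptyset)=0,\mu(\Omega)=1$. An upper probability is a capacity $V$ with $V(A)=\max_{P\in\Lambda}P(A)$ for a weak* (setwise convergence) compact set $\Lambda$ of probabilities; $\operatorname{core}(V)$ is the set of finitely additive normalized $P\le V$. For upper probabilities $V_1,V_2$ on $(\Omega_1,\mathcal{F}_1),(\Omega_2,\mathcal{F}_2)$, the product $V_1\times V_2$ on $\mathcal{F}_1\times\mathcal{F}_2$ is defined by $V_1\times V_2=\max_{(P_1,P_2)\in\operatorname{core}(V_1)\times\operatorname{core}(V_2)}P_1\times P_2$ (product measures); it is an upper probability, invariant under $T_1\times T_2(\omega_1,\omega_2)=(T_1\omega_1,T_2\omega_2)$ when $V_i$ is $T_i$-invariant. A $S$-invariant capacity $\mu$ (i.e. $\mu(S^{-1}A)=\mu(A)$) is ergodic if for every $B$ with $S^{-1}B=B$: $\mu(B)\in\{0,1\}$ and ($\mu(B)=0$ or $\mu(B^c)=0$); it is weakly mixing if every measurable $f$ into $\mathbb{C}$ with $f\circ S=\lambda f$ $\mu$-a.s.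 for some $\lambda\in\mathbb{C}$ is constant $\mu$-a.s. *)

(* Defs.v *)
From HB Require Import structures.
From mathcomp Require Import all_boot all_order all_algebra.
From mathcomp Require Import all_classical all_reals all_analysis.
From mathcomp Require Import complex.

Set Implicit Arguments.
Unset Strict Implicit.
Unset Printing Implicit Defensive.

Import Order.TTheory GRing.Theory Num.Theory.
Local Open Scope classical_set_scope.
Local Open Scope ring_scope.

Section Defs.
Context {d : measure_display} {T : measurableType d} {R : realType}.
Local Open Scope ereal_scope.

Definition capacity (mu : set T -> \bar R) : Prop :=
  [/\ mu set0 = 0, mu setT = 1 &
      forall A B, measurable A -> measurable B -> A `<=` B -> mu A <= mu B].

(* The embedding of a probability into the space of set functions on F,
   equipped with the topology of setwise convergence (pointwise convergence
   on every measurable set). *)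
Definition setwise (P : probability T R) : {ptws set T -> \bar R} :=
  fun A => if `[< measurable A >] then P A else 0.

(* Lam is compact for the weak* (setwise convergence) topology. *)
Definition setwise_compact (Lam : set (probability T R)) : Prop :=
  compact (setwise @` Lam).

Definition upper_probability (V : set T -> \bar R) : Prop :=
  capacity V /\
  exists Lam : set (probability T R),
    setwise_compact Lam /\
    forall A, measurable A ->
      (exists2 P, Lam P & V A = P A) /\ (forall P, Lam P -> P A <= V A).

Definition core (V : set T -> \bar R) (P : set T -> \bar R) : Prop :=
  [/\ P setT = 1,
      (forall A, measurable A -> 0 <= P A),
      (forall A B, measurable A -> measurable B -> A `&` B = set0 ->
         P (A `|` B) = P A + P B) &
      (forall A, measurable A -> P A <= V A)].

Definition cap_invariant (S : T -> T) (mu : set T -> \bar R) : Prop :=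
  forall A, measurable A -> mu (S @^-1` A) = mu A.

Definition cap_ergodic (S : T -> T) (mu : set T -> \bar R) : Prop :=
  forall B, measurable B -> S @^-1` B = B ->
    (mu B = 0 \/ mu B = 1) /\ (mu B = 0 \/ mu (~` B) = 0).

Definition mu_as (mu : set T -> \bar R) (Q : T -> Prop) : Prop :=
  exists N, [/\ measurable N, mu N = 0 & forall x, ~ Q x -> N x].

(* Borel measurability of a complex-valued function
   (Borel sets of C = Borel sets of R^2). *)
Definition cmeasurable (f : T -> complex.complex R) : Prop :=
  measurable_fun setT (fun x => complex.Re (f x)) /\
  measurable_fun setT (fun x => complex.Im (f x)).

Definition weakly_mixing (S : T -> T) (mu : set T -> \bar R) : Prop :=
  forall (f : T -> complex.complex R) (lam : complex.complex R),
    cmeasurable f ->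
    mu_as mu (fun x => f (S x) = (lam * f x)%R) ->
    exists c, mu_as mu (fun x => f x = c).

End Defs.

Section Product.
Context {d1 d2 : measure_display} {T1 : measurableType d1}
  {T2 : measurableType d2} {R : realType}.
Local Open Scope ereal_scope.

(* V1 x V2 = max over (P1, P2) in core(V1) x core(V2) of the product
   measures P1 x P2 (product measures exist for countably additive P_i). *)
Definition prod_upper (V1 : set T1 -> \bar R) (V2 : set T2 -> \bar R)
  : set (T1 * T2) -> \bar R :=
  fun A => ereal_sup [set r | exists (P1 : probability T1 R)
                                     (P2 : probability T2 R),
     [/\ core V1 P1, core V2 P2 &
         r = product_measure1 (P1 : set T1 -> \bar R) (P2 : set T2 -> \bar R) A]].

Definition prod_map (S1 : T1 -> T1) (S2 : T2 -> T2) : T1 * T2 -> T1 * T2 :=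
  fun x => (S1 x.1, S2 x.2).

End Product.

(* Main.v *)
Require Import Defs.
From HB Require Import structures.
From mathcomp Require Import all_boot all_order all_algebra.
From mathcomp Require Import all_classical all_reals all_analysis.
From mathcomp Require Import complex ring lra measurable_realfun.

(** For an ergodic [V], the Banach limit of the Cesaro averages of a measure in
    the core is an invariant measure [Q] in the core; it is countably additive
    because setwise compactness makes [V] continuous from above. Moreover [Q]
    and [V] have the same null sets: if [Q A = 0], the invariant set of points
    visiting [A] infinitely often is [Q]-null, hence [V]-null, while its
    [V]-value is at least [V A]. So everything reduces to the product of two
    invariant probabilities [Q] and [Q'].

    If [B] is invariant for the product and [F] is its centred indicator, then
    [k (x, y) = \int F (x, z) F (y, z) dQ' z] is an invariant symmetric kernel
    killing the constants. If [k] is not null, power iteration produces a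
    nonzero eigenvalue of its square; the eigenspace is finite dimensional and
    stable under composition with [S], so it contains a complex eigenfunction
    of [S], constant by weak mixing and of mean zero, a contradiction. Hence
    [k] is null, [F] is orthogonal to all rectangles, and [B] is null or
    conull. Conversely, if [f (S x) = lam * f x], then [f y / f x] is invariant
    under the product map, hence almost surely constant. *)

Import Order.TTheory GRing.Theory Num.Theory.
Import numFieldNormedType.Exports.
Local Open Scope classical_set_scope.
Local Open Scope ring_scope.

Set Implicit Arguments.
Unset Strict Implicit.
Unset Printing Implicit Defensive.

(** * Bounded measurable functions and their expectations *)

Section BoundedMeasurable.
Context {R : realType}.

(** Boundedness gives integrability for every probability at once and stability under products, so
    integrability conditions reduce to this one predicate. *)
Definition bmf {d} {T : measurableType d} (f : T -> R) :=
  measurable_fun setT f /\ exists M, forall x, `|f x| <= M.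

Context {d : measure_display} {T : measurableType d}.
Implicit Types f g : T -> R.

Lemma bmf_cst (c : R) : bmf (fun _ : T => c).
Proof. by split; [exact: measurable_cst | exists `|c|]. Qed.

Lemma bmfD f g : bmf f -> bmf g -> bmf (fun x => f x + g x).
Proof.
move=> [mf [M fM]] [mg [N gN]]; split; first exact: measurable_funD.
by exists (M + N) => x; rewrite (le_trans (ler_normD _ _))// lerD.
Qed.

Lemma bmfM f g : bmf f -> bmf g -> bmf (fun x => f x * g x).
Proof.
move=> [mf [M fM]] [mg [N gN]]; split; first exact: measurable_funM.
by exists (M * N) => x; rewrite normrM ler_pM.
Qed.

Lemma bmfZ (a : R) f : bmf f -> bmf (fun x => a * f x).
Proof. by move=> bf; apply: bmfM => //; exact: bmf_cst. Qed.

Lemma bmfN f : bmf f -> bmf (fun x => - f x).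
Proof.
move=> [mf [M fM]]; split; first exact: measurable_funN.
by exists M => x; rewrite normrN.
Qed.

Lemma bmfB f g : bmf f -> bmf g -> bmf (fun x => f x - g x).
Proof. by move=> bf bg; apply: bmfD => //; exact: bmfN. Qed.

Lemma bmfX f n : bmf f -> bmf (fun x => f x ^+ n).
Proof.
move=> bf; elim: n => [|n IH]; first exact: bmf_cst.
have -> : (fun x => f x ^+ n.+1) = (fun x => f x * f x ^+ n).
  by apply/funext => x; rewrite exprS.
exact: bmfM.
Qed.

Lemma bmf_norm f : bmf f -> bmf (fun x => `|f x|).
Proof.
move=> [mf [M fM]]; split; first exact: measurableT_comp.
by exists M => x; rewrite normr_id.
Qed.

Lemma bmf_sum n (F : 'I_n -> T -> R) :
  (forall i, bmf (F i)) -> bmf (fun x => \sum_(i < n) F i x).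
Proof.
elim: n F => [|n IH] F bF.
  have -> : (fun x => \sum_(i < 0) F i x) = (fun _ => 0).
    by apply/funext => x; rewrite big_ord0.
  exact: bmf_cst.
have -> : (fun x => \sum_(i < n.+1) F i x) =
    (fun x => \sum_(i < n) F (widen_ord (leqnSn n) i) x + F ord_max x).
  by apply/funext => x; rewrite big_ord_recr.
by apply: bmfD => //; exact: IH.
Qed.

Lemma bmf_indic (A : set T) : measurable A -> bmf (\1_A : T -> R).
Proof.
move=> mA; split; first exact: measurable_indic.
by exists 1 => x; rewrite indicE; case: (_ \in _); rewrite ?normr1 ?normr0.
Qed.

Lemma bmf_comp {d'} {T' : measurableType d'} (f : T -> R) (h : T' -> T) :
  measurable_fun setT h -> bmf f -> bmf (fun x => f (h x)).
Proof.
move=> mh [mf [M fM]]; split; first exact: (measurableT_comp mf mh).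
by exists M.
Qed.

Lemma bmf_ulim (F : nat -> T -> R) f : (forall n, bmf (F n)) ->
  (forall e : R, 0 < e -> exists N, forall n x, (N <= n)%N -> `|F n x - f x| <= e) ->
  bmf f.
Proof.
move=> bF Ff; split.
  apply: (@measurable_fun_cvg _ _ _ setT F) => //; first by move=> n; case: (bF n).
  move=> x _; apply/cvgrPdist_le => /= e e0; have [N HN] := Ff e e0.
  by near=> n; rewrite distrC HN//; near: n; exact: nbhs_infty_ge.
have [N HN] := Ff 1 ltr01; have [_ [M FM]] := bF N.
exists (M + 1) => x; have := HN N x (leqnn N); have := FM x.
by rewrite distrC => h1 h2; have := ler_normD (F N x) (f x - F N x);
  rewrite addrC subrK; lra.
Unshelve. all: by end_near. Qed.

Variable P : probability T R.

Lemma bmf_integrable f : bmf f -> P.-integrable setT (EFin \o f).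
Proof.
move=> [mf [M fM]]; apply: measurable_bounded_integrable => //.
  by rewrite (le_lt_trans (probability_le1 _ _))// ltry.
by exists M; split; [rewrite num_real|move=> y My x _; exact: le_trans (fM x) (ltW My)].
Qed.

Lemma ExpD f g : bmf f -> bmf g ->
  \int[P]_x (f x + g x) = \int[P]_x f x + \int[P]_x g x.
Proof. by move=> bf bg; rewrite RintegralD//; exact: bmf_integrable. Qed.

Lemma ExpB f g : bmf f -> bmf g ->
  \int[P]_x (f x - g x) = \int[P]_x f x - \int[P]_x g x.
Proof. by move=> bf bg; rewrite RintegralB//; exact: bmf_integrable. Qed.

Lemma ExpZ (a : R) f : bmf f -> \int[P]_x (a * f x) = a * \int[P]_x f x.
Proof. by move=> bf; rewrite RintegralZl//; exact: bmf_integrable. Qed.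

Lemma ExpZr (a : R) f : bmf f -> \int[P]_x (f x * a) = \int[P]_x f x * a.
Proof. by move=> bf; rewrite RintegralZr//; exact: bmf_integrable. Qed.

Lemma Exp_cst (a : R) : \int[P]_x a = a.
Proof. by rewrite Rintegral_cst// [X in fine X]probability_setT mulr1. Qed.

Lemma Exp_le f g : bmf f -> bmf g -> (forall x, f x <= g x) ->
  \int[P]_x f x <= \int[P]_x g x.
Proof. by move=> bf bg fg; apply: le_Rintegral => //; exact: bmf_integrable. Qed.

Lemma Exp_ge0 f : (forall x, 0 <= f x) -> 0 <= \int[P]_x f x.
Proof. by move=> f0; exact: Rintegral_ge0. Qed.

Lemma Exp_eq f g : (forall x, f x = g x) -> \int[P]_x f x = \int[P]_x g x.
Proof. by move=> fg; apply: eq_Rintegral => x _. Qed.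

Lemma Exp_norm f : bmf f -> `|\int[P]_x f x| <= \int[P]_x `|f x|.
Proof. by move=> bf; apply: le_normr_Rintegral => //; exact: bmf_integrable. Qed.

Lemma Exp_norm_le f (M : R) : bmf f -> (forall x, `|f x| <= M) ->
  `|\int[P]_x f x| <= M.
Proof.
move=> bf fM; rewrite (le_trans (Exp_norm bf))// -[leRHS]Exp_cst.
by apply: Exp_le => //; [exact: bmf_norm|exact: bmf_cst].
Qed.

Lemma Exp_sum n (F : 'I_n -> T -> R) : (forall i, bmf (F i)) ->
  \int[P]_x (\sum_(i < n) F i x) = \sum_(i < n) \int[P]_x F i x.
Proof.
elim: n F => [|n IH] F bF.
  by rewrite big_ord0 (Exp_eq (g := fun=> 0)) ?Exp_cst// => x; rewrite big_ord0.
rewrite big_ord_recr /= -IH// -ExpD//; last exact: bmf_sum.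
by apply: Exp_eq => x; rewrite big_ord_recr.
Qed.

(** The quadratic form in [s], [t] below is the expectation of a square, hence nonnegative; for [c]
    nonzero, taking [s = c] and [t = - b] gives the inequality. *)
Lemma Exp_CS f g : bmf f -> bmf g ->
  (\int[P]_x (f x * g x)) ^+ 2 <= (\int[P]_x f x ^+ 2) * (\int[P]_x g x ^+ 2).
Proof.
move=> bf bg; set a := \int[P]_x f x ^+ 2; set b := \int[P]_x (f x * g x).
set c := \int[P]_x g x ^+ 2.
have a0 : 0 <= a by apply: Exp_ge0 => x; exact: sqr_ge0.
have c0 : 0 <= c by apply: Exp_ge0 => x; exact: sqr_ge0.
have key s t : 0 <= s ^+ 2 * a + (2 * s * t) * b + t ^+ 2 * c.
  have -> : s ^+ 2 * a + (2 * s * t) * b + t ^+ 2 * c =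
      \int[P]_x (s * f x + t * g x) ^+ 2.
    rewrite -!ExpZ; do ?[exact: bmfM|exact: bmfX].
    rewrite -ExpD; [|by apply: bmfZ; exact: bmfX|by apply: bmfZ; exact: bmfM].
    rewrite -ExpD; last by apply: bmfZ; exact: bmfX.
      by apply: Exp_eq => x; ring.
    by apply: bmfD; apply: bmfZ; [exact: bmfX|exact: bmfM].
  by apply: Exp_ge0 => x; exact: sqr_ge0.
have [c_eq0|c_neq0] := eqVneq c 0.
  have [->|b0] := eqVneq b 0; first by rewrite expr0n /= mulr_ge0.
  (* When [c = 0] and [b] is nonzero, this [t] brings the form down to -1, which is absurd. *)
  have := key 1 (- (a + 1) / (2 * b)).
  rewrite c_eq0 (_ : 1 ^+ 2 * a + _ + _ = -1) ?ler0N1//.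
  by field.
have {}c0 : 0 < c by rewrite lt_def c_neq0.
have := key c (- b); rewrite (_ : _ + _ + _ = c * (a * c - b ^+ 2)); last by ring.
by rewrite pmulr_rge0// subr_ge0.
Qed.

(** By Cauchy-Schwarz. This is the working form of almost sure vanishing: orthogonality to every
    bounded function. *)
Lemma Exp_sqr_eq0 f g : bmf f -> bmf g -> \int[P]_x f x ^+ 2 = 0 ->
  \int[P]_x (f x * g x) = 0.
Proof.
move=> bf bg f0; have := Exp_CS bf bg; rewrite f0 mul0r => h.
by apply/eqP; rewrite -sqrf_eq0 eq_le h sqr_ge0.
Qed.

Lemma Exp_sqr_le f : bmf f -> (\int[P]_x f x) ^+ 2 <= \int[P]_x f x ^+ 2.
Proof.
move=> bf; have := Exp_CS bf (bmf_cst 1); rewrite (Exp_eq (g := f)); last first.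
  by move=> x; rewrite mulr1.
by rewrite expr1n Exp_cst mulr1.
Qed.

Lemma Exp_EFin f : bmf f -> (\int[P]_x f x)%:E = (\int[P]_x (f x)%:E)%E.
Proof.
by move=> bf; rewrite fineK//; apply: integrable_fin_num => //; exact: bmf_integrable.
Qed.

Lemma Exp_indic (A : set T) : measurable A -> \int[P]_x \1_A x = fine (P A).
Proof. by move=> mA; rewrite /Rintegral integral_indic// setIT. Qed.

Lemma Exp_inv (S : T -> T) f : measurable_fun setT S ->
  (forall A, measurable A -> P (S @^-1` A) = P A) -> bmf f ->
  \int[P]_x f (S x) = \int[P]_x f x.
Proof.
move=> mS PS bf; congr fine.
have bfS : bmf (f \o S) by exact: bmf_comp.
have mf : measurable_fun setT (EFin \o f) by apply/measurable_EFinP; case: bf.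
transitivity (\int[pushforward P S]_y (EFin \o f) y)%E.
  by rewrite integral_pushforward//; exact: (bmf_integrable bfS).
by apply: eq_measure_integral => A mA _ /=; rewrite /pushforward PS.
Qed.

End BoundedMeasurable.

(** * Fubini's theorem for bounded functions *)

Section BoundedFubini.
Context {R : realType} {d1 d2 : measure_display}.
Context {T1 : measurableType d1} {T2 : measurableType d2}.
Variable P2 : probability T2 R.
Implicit Types f : T1 * T2 -> R.

Lemma bmf_sec1 f y : bmf f -> bmf (fun x => f (x, y)).
Proof. by move=> bf; apply: (bmf_comp _ bf); exact: pair2_measurable. Qed.

Lemma bmf_sec2 f x : bmf f -> bmf (fun y => f (x, y)).
Proof. by move=> bf; apply: (bmf_comp _ bf); exact: pair1_measurable. Qed.

Lemma bmf_int2 f : bmf f -> bmf (fun x => \int[P2]_y f (x, y)).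
Proof.
move=> bf; have [_ [M fM]] := bf; split; last first.
  by exists M => x; apply: Exp_norm_le => //; exact: bmf_sec2.
(* Adding the bound [M] makes the integrand nonnegative, so Tonelli's measurability statement
   applies. *)
have bfM : bmf (fun z => f z + M) by apply: bmfD => //; exact: bmf_cst.
have -> : (fun x => \int[P2]_y f (x, y)) =
    (fun x => \int[P2]_y (f (x, y) + M) - M).
  apply/funext => x; rewrite ExpD ?Exp_cst ?addrK//; last exact: bmf_cst.
  exact: bmf_sec2.
apply: measurable_funB => //; apply/measurable_EFinP.
have -> : EFin \o (fun x => \int[P2]_y (f (x, y) + M)) =
    fubini_F P2 (EFin \o (fun z => f z + M)).
  by apply/funext => x /=; rewrite Exp_EFin//; exact: (bmf_sec2 x bfM).
apply: measurable_fun_fubini_tonelli_F.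
  by apply/measurable_EFinP; case: bfM.
by move=> z; rewrite lee_fin -lerBlDr sub0r; have := fM z; rewrite ler_norml => /andP[].
Qed.

End BoundedFubini.

Section BoundedFubiniSwap.
Context {R : realType} {d1 d2 : measure_display}.
Context {T1 : measurableType d1} {T2 : measurableType d2}.
Variables (P1 : probability T1 R) (P2 : probability T2 R).
Implicit Types f : T1 * T2 -> R.

Lemma bmf_int1 f : bmf f -> bmf (fun y => \int[P1]_x f (x, y)).
Proof.
move=> bf; apply: (bmf_int2 P1 (f := fun z : T2 * T1 => f (z.2, z.1))).
by apply: bmf_comp => //; apply: measurable_fun_pair.
Qed.

Lemma Exp_prod12 f : bmf f ->
  \int[P1]_x (\int[P2]_y f (x, y)) = \int[(P1 \x P2)%E]_z f z.
Proof.
move=> bf; apply: EFin_inj; rewrite !Exp_EFin//; last exact: bmf_int2.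
rewrite -(integral12_prod_meas1 (bmf_integrable (P1 \x P2)%E bf)).
by apply: eq_integral => x _; rewrite Exp_EFin//; exact: bmf_sec2.
Qed.

Lemma Exp_prod21 f : bmf f ->
  \int[P2]_y (\int[P1]_x f (x, y)) = \int[(P1 \x P2)%E]_z f z.
Proof.
move=> bf; apply: EFin_inj; rewrite !Exp_EFin//; last exact: bmf_int1.
rewrite -(integral21_prod_meas1 (bmf_integrable (P1 \x P2)%E bf)).
by apply: eq_integral => x _; rewrite Exp_EFin//; exact: bmf_sec1.
Qed.

Lemma Exp_swap f : bmf f ->
  \int[P1]_x (\int[P2]_y f (x, y)) = \int[P2]_y (\int[P1]_x f (x, y)).
Proof. by move=> bf; rewrite Exp_prod12// Exp_prod21. Qed.

End BoundedFubiniSwap.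

Ltac mproj := repeat first
  [ exact: measurable_fst | exact: measurable_snd | exact: measurable_id
  | exact: measurable_cst | apply: measurable_fun_pair
  | apply: (measurableT_comp measurable_fst) | apply: (measurableT_comp measurable_snd)].

(** The limit is taken pointwise; letting [m] tend to infinity in the Cauchy bound shows that it is
    uniform. *)
Lemma uniform_cauchy_cvg {R : realType} {X : Type} (F : nat -> X -> R) :
  (forall e : R, 0 < e -> exists N, forall n m x, (N <= n)%N -> (N <= m)%N ->
     `|F n x - F m x| <= e) ->
  exists f : X -> R, forall e : R, 0 < e ->
    exists N, forall n x, (N <= n)%N -> `|F n x - f x| <= e.
Proof.
move=> FC; have Fcvg x : cvgn (fun n => F n x).
  apply/cauchy_cvgP/cauchy_exP => e e0.
  have [N HN] := FC (e / 2) (divr_gt0 e0 (ltr0n _ 2)).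
  exists (F N x); exists N => // n /= Nn; rewrite /ball /=.
  by rewrite (le_lt_trans (HN _ _ x (leqnn N) Nn))// ltr_pdivrMr// ltr_pMr// ltr1n.
exists (fun x => limn (fun n => F n x)) => e e0; have [N HN] := FC e e0.
exists N => n x nN.
have h : `|F n x - F m x| @[m --> \oo] --> `|F n x - limn (fun n => F n x)|.
  by apply: cvg_norm; apply: cvgB; [exact: cvg_cst|exact: Fcvg].
rewrite -(cvg_lim _ h)//; apply: limr_le; first by apply/cvg_ex; eexists; exact: h.
by near=> m; apply: HN => //; near: m; exact: nbhs_infty_ge.
Unshelve. all: by end_near. Qed.

(** * Ratios of a submultiplicative log-convex sequence *)

Section RatioLimit.
Context {R : realType}.
Variable t : nat -> R.
Hypotheses (t0 : 0 < t 0) (t1 : 0 < t 1).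
Hypothesis t_submult : forall n m, t (n + m).+1 <= t n * t m.
Hypothesis t_logconvex : forall n, t n.+1 ^+ 2 <= t n * t n.+2.

Let t_gt0 n : 0 < t n.
Proof.
suff: 0 < t n /\ 0 < t n.+1 by case.
elim: n => // n [h1 h2]; split=> //.
have := t_logconvex n; rewrite -(pmulr_rgt0 _ h1).
by apply: lt_le_trans; rewrite exprn_gt0.
Qed.

Let rho n := t n.+1 / t n.

Let rhoE n : t n.+1 = rho n * t n.
Proof. by rewrite /rho divfK// gt_eqF// t_gt0. Qed.

Let rho_gt0 n : 0 < rho n.
Proof. by rewrite divr_gt0// t_gt0. Qed.

(** Log-convexity rewritten in terms of ratios; with the upper bound [t 0] coming from
    submultiplicativity, it makes [rho] converge. *)
Let rho_nd : nondecreasing_seq rho.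
Proof.
apply/nondecreasing_seqP => n; rewrite /rho ler_pdivrMr ?t_gt0//.
rewrite mulrAC ler_pdivlMr ?t_gt0// -expr2.
by rewrite mulrC; exact: t_logconvex.
Qed.

Let rho_ub n : rho n <= t 0.
Proof.
rewrite ler_pdivrMr ?t_gt0// mulrC.
by have := t_submult n 0; rewrite addn0.
Qed.

Let r := limn rho.

Let rho_cvg : cvgn rho.
Proof.
apply: nondecreasing_is_cvgn => //.
by exists (t 0) => _ [n _ <-].
Qed.

Let rho_le n : rho n <= r.
Proof. exact: nondecreasing_cvgn_le. Qed.

Let r_gt0 : 0 < r.
Proof. exact: lt_le_trans (rho_gt0 0) (rho_le 0). Qed.

Let tau_grow n N : rho n ^+ N * t n <= t (n + N).
Proof.
elim: N => [|N IH]; first by rewrite expr0 mul1r addn0.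
rewrite exprS -mulrA addnS rhoE ler_pM//.
- exact: ltW.
- by rewrite mulr_ge0// ?exprn_ge0// ltW// t_gt0.
- by apply: rho_nd; exact: leq_addr.
Qed.

(** Since [rho n ^+ N.+1 * t n <= t (n + N).+1 <= t n * t N], cancel [t n] and let [n] tend to
    infinity. *)
Let tau_ge N : r ^+ N.+1 <= t N.
Proof.
have h n : rho n ^+ N.+1 <= t N.
  rewrite -(ler_pM2r (t_gt0 n)) (mulrC (t N)).
  by apply: le_trans (tau_grow n N.+1) _; rewrite addnS; exact: t_submult.
have c : rho n ^+ N.+1 @[n --> \oo] --> r ^+ N.+1.
  by apply: (@continuous_cvg _ _ _ _ _ _ (fun x : R => x ^+ N.+1)) => //;
    exact: exprn_continuous.
rewrite -(cvg_lim _ c)//; apply: limr_le; first by apply/cvg_ex; eexists; exact: c.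
exact: nearW.
Qed.

Let s n := t n / r ^+ n.+1.

Let rX n : 0 < r ^+ n.
Proof. by rewrite exprn_gt0. Qed.

Let s_ge1 n : 1 <= s n.
Proof. by rewrite ler_pdivlMr// mul1r. Qed.

(** Going from [s n] to [s n.+1] multiplies by [rho n / r], which is at most 1. *)
Let s_ni : nonincreasing_seq s.
Proof.
apply/nonincreasing_seqP => n; rewrite /s ler_pdivrMr// (exprS _ n.+1) mulrCA.
by rewrite mulfVK ?gt_eqF// rhoE ler_pM2r ?t_gt0.
Qed.

Let s_cauchy e : 0 < e -> exists N, forall n m, (N <= n)%N -> (N <= m)%N ->
  s n - s m <= e.
Proof.
move=> e0; have sc : cvgn s.
  apply: nonincreasing_is_cvgn => //.
  by exists 1 => _ [n _ <-].
have /cvgrPdist_le /(_ e e0) [N _ HN] := sc.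
exists N => n m Nn Nm; have := HN n Nn; rewrite /= distrC.
have := nonincreasing_cvgn_ge s_ni sc m.
by move=> h1 h2; have := ler_norm (s n - limn s); lra.
Qed.

(** Meant for [t n] the squared norm of the (n+1)-st power of a symmetric kernel, whence the
    exponent [n.+1]; [r] then plays the role of the top eigenvalue of the squared kernel. *)
Lemma ratio_limit : exists r : R, [/\ 0 < r, forall n, 1 <= t n / r ^+ n.+1 &
  forall e, 0 < e -> exists N, forall n m, (N <= n)%N -> (N <= m)%N ->
    t n / r ^+ n.+1 - t m / r ^+ m.+1 <= e].
Proof. by exists r; split. Qed.

End RatioLimit.

(** * Kernels as Hilbert-Schmidt operators *)

Section KernelAlgebra.
Context {R : realType}.

(** Composition of integral operators; [kdot] is the Hilbert-Schmidt inner product and [ktr] the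
    adjoint. The spaces may differ, since the centred indicator of an invariant set is a kernel
    between two systems. *)
Definition kmul {d1 d2 d3} {T1 : measurableType d1} {T2 : measurableType d2}
    {T3 : measurableType d3} (P2 : probability T2 R)
    (a : T1 * T2 -> R) (b : T2 * T3 -> R) : T1 * T3 -> R :=
  fun z => \int[P2]_w (a (z.1, w) * b (w, z.2)).

Definition kdot {d1 d2} {T1 : measurableType d1} {T2 : measurableType d2}
    (P1 : probability T1 R) (P2 : probability T2 R) (a b : T1 * T2 -> R) : R :=
  \int[(P1 \x P2)%E]_z (a z * b z).

Definition ktr {T1 T2 : Type} (a : T1 * T2 -> R) : T2 * T1 -> R :=
  fun z => a (z.2, z.1).

Context {d1 d2 d3 d4 : measure_display} {T1 : measurableType d1}
  {T2 : measurableType d2} {T3 : measurableType d3} {T4 : measurableType d4}.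
Variables (P1 : probability T1 R) (P2 : probability T2 R)
  (P3 : probability T3 R).

Lemma bmf_ktr (a : T1 * T2 -> R) : bmf a -> bmf (ktr a).
Proof. by move=> ba; apply: bmf_comp => //; mproj. Qed.

Lemma bmf_kmul (a : T1 * T2 -> R) (b : T2 * T3 -> R) :
  bmf a -> bmf b -> bmf (kmul P2 a b).
Proof.
move=> ba bb.
have := bmf_int2 P2 (f := fun u : (T1 * T3) * T2 => a (u.1.1, u.2) * b (u.2, u.1.2)).
by apply; apply: bmfM; apply: bmf_comp => //; mproj.
Qed.

Lemma kmulA (a : T1 * T2 -> R) (b : T2 * T3 -> R) (c : T3 * T4 -> R) :
  bmf a -> bmf b -> bmf c ->
  kmul P3 (kmul P2 a b) c = kmul P2 a (kmul P3 b c).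
Proof.
move=> ba bb bc; apply/funext => -[x y]; rewrite /kmul /=.
transitivity (\int[P3]_w \int[P2]_v (a (x, v) * b (v, w) * c (w, y))).
  apply: Exp_eq => w; rewrite -ExpZr//.
  by apply: bmfM; [exact: bmf_sec2|exact: bmf_sec1].
rewrite (Exp_swap P3 P2 (f := fun z : T3 * T2 => a (x, z.2) * b (z.2, z.1) * c (z.1, y))).
  apply: Exp_eq => v; rewrite -ExpZ; first by apply: Exp_eq => w /=; rewrite mulrA.
  by apply: bmfM; [exact: bmf_sec2|exact: bmf_sec1].
by apply: bmfM; [apply: bmfM|]; apply: bmf_comp => //; mproj.
Qed.

Lemma kdotC (a b : T1 * T2 -> R) : kdot P1 P2 a b = kdot P1 P2 b a.
Proof. by apply: Exp_eq => z; rewrite mulrC. Qed.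

Lemma kdotE (a b : T1 * T2 -> R) : bmf a -> bmf b ->
  kdot P1 P2 a b = \int[P1]_x \int[P2]_y (a (x, y) * b (x, y)).
Proof.
by move=> ba bb; rewrite /kdot -(Exp_prod12 P1 P2)//; exact: bmfM.
Qed.

Lemma kdot_ge0 (a : T1 * T2 -> R) : 0 <= kdot P1 P2 a a.
Proof. by apply: Exp_ge0 => z; rewrite -expr2 sqr_ge0. Qed.

Lemma kdot_CS (a b : T1 * T2 -> R) : bmf a -> bmf b ->
  kdot P1 P2 a b ^+ 2 <= kdot P1 P2 a a * kdot P1 P2 b b.
Proof. by move=> ba bb; exact: Exp_CS. Qed.

(** Both sides are the triple integral of [a (x, w) * b (w, y) * c (x, y)], with [y] and [w]
    integrated in opposite orders. *)
Lemma kdot_adjoint (a : T1 * T2 -> R) (b : T2 * T3 -> R) (c : T1 * T3 -> R) :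
  bmf a -> bmf b -> bmf c ->
  kdot P1 P3 (kmul P2 a b) c = kdot P1 P2 a (kmul P3 c (ktr b)).
Proof.
move=> ba bb bc; have btb : bmf (ktr b) by apply: bmf_comp => //; mproj.
have bctb : bmf (kmul P3 c (ktr b)).
  have := bmf_int2 P3 (f := fun u : (T1 * T2) * T3 => c (u.1.1, u.2) * ktr b (u.2, u.1.2)).
  by apply; apply: bmfM; apply: bmf_comp => //; mproj.
rewrite (kdotE ba bctb) {1}/kdot -(Exp_prod12 P1 P3); last first.
  by apply: bmfM => //; exact: bmf_kmul.
apply: Exp_eq => x; rewrite /kmul /=.
transitivity (\int[P3]_y \int[P2]_w (a (x, w) * b (w, y) * c (x, y))).
  apply: Exp_eq => y; rewrite -ExpZr//.
  by apply: bmfM; [exact: bmf_sec2|exact: bmf_sec1].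
rewrite (Exp_swap P3 P2 (f := fun z : T3 * T2 => a (x, z.2) * b (z.2, z.1) * c (x, z.1))).
  apply: Exp_eq => w; rewrite -ExpZ.
    by apply: Exp_eq => y /=; rewrite -mulrA (mulrC (b _)).
  by apply: bmfM; [exact: bmf_sec2|exact: (bmf_sec1 w btb)].
by apply: bmfM; [apply: bmfM|]; apply: bmf_comp => //; mproj.
Qed.

End KernelAlgebra.

(** * Power iteration for a symmetric kernel *)

Section Kernels.
Context {R : realType} {d : measure_display} {T : measurableType d}.
Variable P : probability T R.
Implicit Types a b c : T * T -> R.

Local Notation kmul := (kmul P).
Local Notation kdot := (kdot P P).

Lemma kmulZl (l : R) a b : bmf a -> bmf b ->
  kmul (fun z => l * a z) b = (fun z => l * kmul a b z).
Proof.
move=> ba bb; apply/funext => z; rewrite /kmul -ExpZ.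
  by apply: Exp_eq => w; rewrite mulrA.
by apply: bmfM; [exact: bmf_sec2|exact: bmf_sec1].
Qed.

Lemma kmulZr (l : R) a b : bmf a -> bmf b ->
  kmul a (fun z => l * b z) = (fun z => l * kmul a b z).
Proof.
move=> ba bb; apply/funext => z; rewrite /kmul -ExpZ.
  by apply: Exp_eq => w; rewrite mulrCA.
by apply: bmfM; [exact: bmf_sec2|exact: bmf_sec1].
Qed.

Lemma kmulBr a b c : bmf a -> bmf b -> bmf c ->
  kmul a (fun z => b z - c z) = (fun z => kmul a b z - kmul a c z).
Proof.
move=> ba bb bc; apply/funext => z; rewrite /kmul -ExpB.
- by apply: Exp_eq => w; rewrite mulrBr.
- by apply: bmfM; [exact: bmf_sec2|exact: bmf_sec1].
- by apply: bmfM; [exact: bmf_sec2|exact: bmf_sec1].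
Qed.

Lemma kmulBl a b c : bmf a -> bmf b -> bmf c ->
  kmul (fun z => b z - c z) a = (fun z => kmul b a z - kmul c a z).
Proof.
move=> ba bb bc; apply/funext => z; rewrite /kmul -ExpB.
- by apply: Exp_eq => w; rewrite mulrBl.
- by apply: bmfM; [exact: bmf_sec2|exact: bmf_sec1].
- by apply: bmfM; [exact: bmf_sec2|exact: bmf_sec1].
Qed.

(** Cauchy-Schwarz in the middle variable bounds the square at each point by a function of [x] times
    a function of [y], which integrates to the product of the norms. *)
Lemma kdot_submult a b : bmf a -> bmf b ->
  kdot (kmul a b) (kmul a b) <= kdot a a * kdot b b.
Proof.
move=> ba bb; have bab := bmf_kmul P ba bb.
have b2a : bmf (fun z => a z * a z) by exact: bmfM.
have b2b : bmf (fun z => b z * b z) by exact: bmfM.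
rewrite (kdotE _ _ bab bab).
have -> : kdot a a * kdot b b =
    \int[P]_x \int[P]_y ((\int[P]_w (a (x, w) * a (x, w))) *
                         (\int[P]_w (b (w, y) * b (w, y)))).
  rewrite (kdotE _ _ ba ba) /kdot -(Exp_prod21 P P b2b) -ExpZr; last exact: (bmf_int2 P b2a).
  apply: Exp_eq => x; rewrite -ExpZ//; exact: (bmf_int1 P b2b).
have b1 : bmf (fun u : T * T => kmul a b u * kmul a b u) by exact: bmfM.
have b2 : bmf (fun u : T * T => (\int[P]_w (a (u.1, w) * a (u.1, w))) *
                         (\int[P]_w (b (w, u.2) * b (w, u.2)))).
  apply: bmfM.
    apply: (bmf_comp (f := fun x => \int[P]_w (a (x, w) * a (x, w)))); first by mproj.
    exact: (bmf_int2 P b2a).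
  apply: (bmf_comp (f := fun y => \int[P]_w (b (w, y) * b (w, y)))); first by mproj.
  exact: (bmf_int1 P b2b).
apply: Exp_le; [exact: (bmf_int2 P b1)|exact: (bmf_int2 P b2)|move=> x].
apply: Exp_le; [exact: (bmf_sec2 x b1)|exact: (bmf_sec2 x b2)|move=> y].
by rewrite -expr2 /kmul /=; apply: Exp_CS; [exact: bmf_sec2|exact: bmf_sec1].
Qed.

(** Composing on both sides with a kernel bounded by 1 bounds the values by the L1 norm of [a],
    hence by its L2 norm. This upgrades L2 convergence to uniform convergence. *)
Lemma kmul_sandwich k a z : bmf k -> (forall u, `|k u| <= 1) -> bmf a ->
  (kmul k (kmul a k) z) ^+ 2 <= kdot a a.
Proof.
move=> bk k1 ba.
have bna : bmf (fun u => `|a u|) by exact: bmf_norm.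
have h : `|kmul k (kmul a k) z| <= \int[(P \x P)%E]_u `|a u|.
  rewrite -(Exp_prod12 P P)//.
  have bak : bmf (kmul a k) by exact: bmf_kmul.
  have bb : bmf (fun w => k (z.1, w) * kmul a k (w, z.2)).
    by apply: bmfM; [exact: bmf_sec2|exact: bmf_sec1].
  apply: (le_trans (Exp_norm P bb)); apply: Exp_le.
  - exact: bmf_norm.
  - exact: (bmf_int2 P bna).
  move=> u; rewrite normrM.
  have bc : bmf (fun w => a (u, w) * k (w, z.2)).
    by apply: bmfM; [exact: bmf_sec2|exact: bmf_sec1].
  have : `|kmul a k (u, z.2)| <= \int[P]_y `|a (u, y)|.
    apply: (le_trans (Exp_norm P bc)); apply: Exp_le.
    - exact: bmf_norm.
    - exact: (bmf_sec2 u bna).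
    by move=> v; rewrite normrM ler_piMr.
  by apply: le_trans; rewrite ler_piMl.
rewrite -real_normK ?num_real//; apply: (@le_trans _ _ ((\int[(P \x P)%E]_u `|a u|) ^+ 2)).
  by rewrite lerXn2r// nnegrE (le_trans _ h).
apply: (le_trans (Exp_sqr_le _ bna)); rewrite /kdot le_eqVlt; apply/orP; left; apply/eqP.
by apply: Exp_eq => u; rewrite real_normK ?num_real// expr2.
Qed.

Section Powers.
Variable k : T * T -> R.
Hypotheses (bk : bmf k) (sk : ktr k = k) (k1 : forall z, `|k z| <= 1).

(* [kpow n] is the (n+1)-st power of [k]. *)
Fixpoint kpow n := if n is m.+1 then kmul (kpow m) k else k.

Lemma bmf_kpow n : bmf (kpow n).
Proof. by elim: n => //= n IH; exact: bmf_kmul. Qed.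

Lemma kpow_comp n m : kmul (kpow n) (kpow m) = kpow (n + m).+1.
Proof.
elim: m => [|m IH]; first by rewrite addn0.
rewrite [kpow m.+1]/= -kmulA ?IH ?addnS//; exact: bmf_kpow.
Qed.

Definition ktau n := kdot (kpow n) (kpow n).

Lemma kdot_kpowS n m : kdot (kpow n.+1) (kpow m) = kdot (kpow n) (kpow m.+1).
Proof. by rewrite /= kdot_adjoint ?sk//; exact: bmf_kpow. Qed.

Lemma kdot_kpowD n m : kdot (kpow (n + m.*2)) (kpow n) = ktau (n + m).
Proof.
elim: m n => [|m IH] n; first by rewrite addn0.
by rewrite doubleS !addnS kdot_kpowS -addSn IH addSn.
Qed.

(** The index [n.*2.+1] denotes the power 2n+2. By symmetry of [k] only the total exponent 2n+2m+4
    matters, and it splits into two equal halves n+m+2. *)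
Lemma kdot_kpow_even n m : kdot (kpow n.*2.+1) (kpow m.*2.+1) = ktau (n + m).+1.
Proof.
have [nm|/ltnW mn] := leqP m n.
  have := kdot_kpowD m.*2.+1 (n - m); rewrite doubleB.
  rewrite addSn subnKC; last by rewrite leq_double.
  move=> ->; congr ktau; rewrite -addnn.
  by rewrite addSn -addnA subnKC// addnC.
have := kdot_kpowD n.*2.+1 (m - n); rewrite doubleB kdotC.
rewrite addSn subnKC; last by rewrite leq_double.
  move=> ->; congr ktau; rewrite -addnn.
by rewrite addSn -addnA subnKC// addnC.
Qed.

Lemma ktau_submult n m : ktau (n + m).+1 <= ktau n * ktau m.
Proof. by rewrite /ktau -kpow_comp; apply: kdot_submult; exact: bmf_kpow. Qed.

(** [ktau n.+1] is also the inner product of [kpow n.+2] and [kpow n], to which Cauchy-Schwarz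
    applies. *)
Lemma ktau_logconvex n : ktau n.+1 ^+ 2 <= ktau n * ktau n.+2.
Proof.
have := kdot_kpowD n 1; rewrite addn1 addn2 => <-; rewrite mulrC.
by apply: kdot_CS; exact: bmf_kpow.
Qed.

Variable r : R.
Hypothesis r_gt0 : 0 < r.
Let s n := ktau n / r ^+ n.+1.
Hypothesis s_ge1 : forall n, 1 <= s n.
Hypothesis s_cauchy : forall e, 0 < e ->
  exists N, forall n m, (N <= n)%N -> (N <= m)%N -> s n - s m <= e.

(** The power n+1 of [k] squared, divided by [r ^+ n.+1]; the expected limit is the projection onto
    the top eigenspace of the squared kernel. *)
Let q n : T * T -> R := fun z => (r ^+ n.+1)^-1 * kpow n.*2.+1 z.

Let bq n : bmf (q n).
Proof. by apply: bmfZ; exact: bmf_kpow. Qed.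

(** The Gram matrix depends on [n + m] only, so the Cauchy property of [s] makes [q] Cauchy in
    L2. *)
Let kdot_q n m : kdot (q n) (q m) = s (n + m).+1.
Proof.
rewrite /s -kdot_kpow_even /kdot mulrC -ExpZ; last first.
  by apply: bmfM; exact: bmf_kpow.
apply: Exp_eq => z; rewrite /q -addSn -addnS exprD invfM.
by ring.
Qed.

Let kdot_qB n m : kdot (fun z => q n z - q m z) (fun z => q n z - q m z) =
  s (n + n).+1 - s (n + m).+1 + (s (m + m).+1 - s (n + m).+1).
Proof.
rewrite -!kdot_q /kdot -!ExpB; do ?exact: bmfM.
rewrite -ExpD; [|by apply: bmfB; exact: bmfM..].
by apply: Exp_eq => z; ring.
Qed.

(** Writing [q n.+1] as a two-sided composition with [k] prepares the use of [kmul_sandwich]. *)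
Let q_rec n : q n.+1 = (fun z => r^-1 * kmul k (kmul (q n) k) z).
Proof.
rewrite /q kmulZl ?kmulZr//; do ?[exact: bmf_kmul|exact: bmf_kpow].
  apply/funext => z; rewrite exprS invfM mulrA; congr (_ * _).
  by rewrite -[kmul (kpow _) k]/(kpow n.*2.+2) -[X in kmul X]/(kpow 0) kpow_comp.
by apply: bmf_kmul => //; exact: bmf_kpow.
Qed.

Let q_ucauchy e : 0 < e -> exists N, forall n m z, (N <= n)%N -> (N <= m)%N ->
  `|q n z - q m z| <= e.
Proof.
(* The factor [r] absorbs the [r^-1] of [q_rec], and the half is for the two differences of [s] in
   [kdot_qB]. *)
move=> e0; have [|N HN] := @s_cauchy ((e * r) ^+ 2 / 2).
  by rewrite divr_gt0// exprn_gt0// mulr_gt0.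
exists N.+1 => -[//|n] [//|m] z; rewrite !ltnS => Nn Nm.
rewrite !q_rec -mulrBr normrM gtr0_norm ?invr_gt0// mulrC ler_pdivrMr//.
rewrite -(@ler_pXn2r _ 2) ?nnegrE ?mulr_ge0 ?(ltW e0) ?(ltW r_gt0)//.
have bqn := bq n; have bqm := bq m.
have -> : kmul k (kmul (q n) k) z - kmul k (kmul (q m) k) z =
   kmul k (kmul (fun u => q n u - q m u) k) z.
  by rewrite kmulBl// kmulBr//; exact: bmf_kmul.
rewrite real_normK ?num_real//.
have bqB : bmf (fun u => q n u - q m u) by exact: bmfB.
apply: (le_trans (kmul_sandwich z bk k1 bqB)).
rewrite kdot_qB.
have h1 : s (n + n).+1 - s (n + m).+1 <= (e * r) ^+ 2 / 2.
  by apply: HN; rewrite leqW// (leq_trans Nn)// leq_addr.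
have h2 : s (m + m).+1 - s (n + m).+1 <= (e * r) ^+ 2 / 2.
  by apply: HN; rewrite leqW// (leq_trans Nm)// leq_addl.
by lra.
Qed.

(* Power iteration: [k^(2n) / r^n] converges uniformly to a nonzero kernel whose
   columns are eigenfunctions.  Nonzero because the Hilbert-Schmidt norms are
   submultiplicative, so that [ktau n >= r^(n+1)]. *)
Lemma kernel_eigenfunction_of : exists (l : R) (g : T -> R),
  [/\ 0 < l, bmf g, (exists x, g x != 0) &
      forall x, \int[P]_y (kmul k k (x, y) * g y) = l * g x].
Proof.
have [p Hp] := uniform_cauchy_cvg q_ucauchy.
have bp : bmf p by exact: bmf_ulim Hp.
have [[x y] pxy] : exists z, p z != 0.
  apply/not_existsP => p0.
  (* If [p] vanished, some [q N] would be at most 1/2 everywhere and have squared norm at most 1/4,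
     against [s_ge1]. *)
  have [N HN] := Hp (1/2) ltac:(lra).
  have : kdot (q N) (q N) <= 1/4.
    rewrite /kdot -[leRHS](Exp_cst (P \x P)%E); apply: Exp_le.
    - exact: bmfM.
    - exact: bmf_cst.
    move=> z; have := HN N z (leqnn N); have /negP := p0 z; rewrite negbK => /eqP ->.
    rewrite subr0 => h; rewrite -expr2 -real_normK ?num_real//.
    rewrite (_ : 1/4 = (1/2)^+2); last by field.
    by rewrite lerXn2r// nnegrE; lra.
  by rewrite kdot_q; have := s_ge1 (N + N).+1; lra.
exists r, (fun x => p (x, y)); split=> //; [exact: bmf_sec1|by exists x|].
have bkk : bmf (kmul k k) by exact: bmf_kmul.
move=> {}x {pxy}; rewrite -[LHS]/(kmul (kmul k k) p (x, y)); set z := (x, y).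
apply/eqP; rewrite -subr_eq0 -normr_le0; apply/ler_addgt0Pl => e e0; rewrite addr0.
(* The eigenvalue equation is the limit of the identity [kq] below. Its two error terms carry the
   weights [r] and 1, hence the denominator. *)
have e'0 : 0 < e / (1 + r) by rewrite divr_gt0// addr_gt0.
have [N HN] := Hp _ e'0.
have kq : kmul (kmul k k) (q N) z = r * q N.+1 z.
  rewrite /q kmulZr//; last exact: bmf_kpow.
  rewrite -[kmul k k]/(kpow 1) kpow_comp mulrA; congr (_ * _).
  by rewrite (exprS _ N.+1) invfM mulrA mulfV ?mul1r// gt_eqF.
have -> : kmul (kmul k k) p z - r * p z =
   r * (q N.+1 z - p z) - kmul (kmul k k) (fun u => q N u - p u) z.
  by rewrite kmulBr// kq; ring.
apply: (le_trans (ler_normB _ _)); rewrite normrM (gtr0_norm r_gt0).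
have h1 : `|q N.+1 z - p z| <= e / (1 + r) by exact: HN.
have h2 : `|kmul (kmul k k) (fun u => q N u - p u) z| <= e / (1 + r).
  have bqp : bmf (fun u => q N u - p u) by exact: bmfB.
  apply: Exp_norm_le.
    by apply: bmfM; [exact: bmf_sec2|exact: (bmf_sec1 z.2 bqp)].
  move=> w; rewrite normrM -[leRHS]mul1r ler_pM//; last exact: HN.
  apply: Exp_norm_le; first by apply: bmfM; [exact: bmf_sec2|exact: bmf_sec1].
  by move=> v; rewrite normrM -[leRHS]mul1r ler_pM.
have -> : e = r * (e / (1 + r)) + e / (1 + r).
  by field; rewrite gt_eqF// addr_gt0.
by rewrite lerD// ler_pM2l.
Qed.

End Powers.

Lemma kernel_eigenfunction k : bmf k -> ktr k = k -> (forall z, `|k z| <= 1) ->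
  0 < kdot k k -> 0 < kdot (kmul k k) (kmul k k) ->
  exists (l : R) (g : T -> R), [/\ 0 < l, bmf g, (exists x, g x != 0) &
      forall x, \int[P]_y (kmul k k (x, y) * g y) = l * g x].
Proof.
move=> bk sk k1 t0 t1.
have [r [r0 s1 sC]] := @ratio_limit R (ktau k) t0 t1 (ktau_submult bk)
  (ktau_logconvex bk sk).
exact: kernel_eigenfunction_of s1 sC.
Qed.

End Kernels.

(** * The eigenspace of an invariant kernel *)

Section Eigenspace.
Context {R : realType} {d : measure_display} {T : measurableType d}.
Variables (P : probability T R) (S : T -> T).
Hypothesis mS : measurable_fun setT S.
Hypothesis PS : forall A, measurable A -> P (S @^-1` A) = P A.

Lemma Exp_ae_eq (f g : T -> R) N : bmf f -> bmf g -> measurable N -> P N = 0%E ->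
  (forall x, ~ N x -> f x = g x) -> \int[P]_x f x = \int[P]_x g x.
Proof.
move=> [mf _] [mg _] mN N0 fg; congr fine; apply: ae_eq_integral => //.
- exact/measurable_EFinP.
- exact/measurable_EFinP.
exists N; split=> // x /= h; apply: contrapT => Nx; apply: h => _.
by rewrite fg.
Qed.

Variable K : T * T -> R.
Hypotheses (bK : bmf K) (K1 : forall z, `|K z| <= 1).
Hypothesis KS : forall x y, K (S x, S y) = K (x, y).
Hypothesis Kmean0 : forall y, \int[P]_x K (x, y) = 0.
Variable l : R.
Hypothesis l_gt0 : 0 < l.

(** The equation is imposed at every point, so that an eigenfunction of null norm vanishes
    everywhere and linear relations between eigenfunctions hold without exceptional sets. *)
Definition eigfun (g : T -> R) :=
  bmf g /\ forall x, \int[P]_y (K (x, y) * g y) = l * g x.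

Let bKg g x : bmf g -> bmf (fun y => K (x, y) * g y).
Proof. by move=> bg; apply: bmfM => //; exact: bmf_sec2. Qed.

Lemma eigfunZ a g : eigfun g -> eigfun (fun x => a * g x).
Proof.
move=> [bg gE]; split; first exact: bmfZ.
move=> x; rewrite mulrCA -gE -ExpZ; last exact: bKg.
by apply: Exp_eq => y; rewrite mulrCA.
Qed.

Lemma eigfunB g h : eigfun g -> eigfun h -> eigfun (fun x => g x - h x).
Proof.
move=> [bg gE] [bh hE]; split; first exact: bmfB.
move=> x; rewrite mulrBr -gE -hE -ExpB; [|exact: bKg..].
by apply: Exp_eq => y; rewrite mulrBr.
Qed.

Lemma eigfun_sum n (g : 'I_n -> T -> R) : (forall i, eigfun (g i)) ->
  eigfun (fun x => \sum_(i < n) g i x).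
Proof.
move=> gE; split; first by apply: bmf_sum => i; case: (gE i).
move=> x; rewrite mulr_sumr.
under eq_bigr do rewrite -(gE _).2.
rewrite -Exp_sum; last by move=> i; apply: bKg; case: (gE i).
by apply: Exp_eq => y; rewrite mulr_sumr.
Qed.

(** Replace [y] by [S y] in the integral: both [P] and [K] are invariant. *)
Lemma eigfun_shift g : eigfun g -> eigfun (fun x => g (S x)).
Proof.
move=> [bg gE]; split; first exact: bmf_comp.
move=> x; rewrite -gE -(Exp_inv mS PS (f := fun y => K (S x, y) * g y)); last exact: bKg.
by apply: Exp_eq => y; rewrite KS.
Qed.

Lemma eigfun_eq0 g : eigfun g -> \int[P]_x g x ^+ 2 = 0 -> forall x, g x = 0.
Proof.
move=> [bg gE] g0 x; apply: (mulfI (lt0r_neq0 l_gt0)); rewrite mulr0.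
rewrite -gE -(Exp_sqr_eq0 bg (bmf_sec2 x bK) g0).
by apply: Exp_eq => y; rewrite mulrC.
Qed.

(** Integrate the eigenvalue equation and exchange the integrals: [K] has mean zero in its first
    variable. *)
Lemma eigfun_mean0 g : eigfun g -> \int[P]_x g x = 0.
Proof.
move=> [bg gE]; apply: (mulfI (lt0r_neq0 l_gt0)); rewrite mulr0 -ExpZ//.
under Exp_eq do rewrite -gE.
have bKg2 : bmf (fun z : T * T => K z * g z.2).
  by apply: bmfM => //; apply: bmf_comp => //; mproj.
rewrite (Exp_swap P P bKg2) /= (Exp_eq P (g := fun=> 0)) ?Exp_cst// => y.
by rewrite ExpZr ?Kmean0 ?mul0r//; exact: bmf_sec1.
Qed.

(** Almost surely [g ^+ 2] equals [c * g], whose mean is zero. *)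
Lemma eigfun_ae_cst g c N : eigfun g -> measurable N -> P N = 0%E ->
  (forall x, ~ N x -> g x = c) -> forall x, g x = 0.
Proof.
move=> gE mN N0 gc; have bg := gE.1; apply: eigfun_eq0 => //.
rewrite (Exp_ae_eq (g := fun x => c * g x) _ _ mN N0).
- by rewrite ExpZ// eigfun_mean0// mulr0.
- exact: bmfX.
- exact: bmfZ.
- by move=> x /gc gx; rewrite expr2 {1}gx.
Qed.

Definition orthonormal_eig m (g : 'I_m -> T -> R) :=
  (forall i, eigfun (g i)) /\
  forall i j, \int[P]_x (g i x * g j x) = (i == j)%:R.

Lemma Exp_dot_sum m (g : 'I_m -> T -> R) (c : 'I_m -> R) j : orthonormal_eig g ->
  \int[P]_x ((\sum_(i < m) c i * g i x) * g j x) = c j.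
Proof.
move=> [gE gO].
have b i : bmf (fun x => c i * (g i x * g j x)).
  by apply: bmfZ; apply: bmfM; [case: (gE i)|case: (gE j)].
rewrite (Exp_eq P (g := fun x => \sum_(i < m) c i * (g i x * g j x))).
  rewrite Exp_sum// (bigD1 j)//= big1 => [|i ij].
    rewrite ExpZ ?gO ?eqxx ?mulr1 ?addr0//.
    by apply: bmfM; case: (gE j).
  rewrite ExpZ ?gO ?(negbTE ij) ?mulr0//.
  by apply: bmfM; [case: (gE i)|case: (gE j)].
by move=> x; rewrite mulr_suml; apply: eq_bigr => i _; rewrite mulrA.
Qed.

(** Bessel's inequality for [K (x, _)], whose coefficients are [l * g i x] and whose norm is at most
    1, integrated over [x]. *)
Lemma eigfun_bessel m (g : 'I_m -> T -> R) : orthonormal_eig g ->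
  m%:R * l ^+ 2 <= 1.
Proof.
move=> gO; have [gE gg] := gO; have bg i := (gE i).1.
have pw x : \sum_(i < m) (l * g i x) ^+ 2 <= 1.
  pose h y := \sum_(i < m) (l * g i x) * g i y.
  have bh : bmf h by apply: bmf_sum => i; exact: bmfZ.
  have bKx : bmf (fun y => K (x, y)) by exact: bmf_sec2.
  have hh : \int[P]_y (h y * h y) = \sum_(i < m) (l * g i x) ^+ 2.
    rewrite (Exp_eq P (g := fun y => \sum_(i < m) (l * g i x) * (h y * g i y))).
      rewrite Exp_sum => [|i]; last by apply: bmfZ; exact: bmfM.
      apply: eq_bigr => i _; rewrite ExpZ; last exact: bmfM.
      by rewrite /h (Exp_dot_sum (fun i => l * g i x) i gO) expr2.
    by move=> y; rewrite {2}/h mulr_sumr; apply: eq_bigr => i _; rewrite mulrCA.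
  have Kh : \int[P]_y (K (x, y) * h y) = \sum_(i < m) (l * g i x) ^+ 2.
    rewrite (Exp_eq P (g := fun y => \sum_(i < m) (l * g i x) * (K (x, y) * g i y))).
      rewrite Exp_sum => [|i]; last by apply: bmfZ; exact: bmfM.
      apply: eq_bigr => i _; rewrite ExpZ; last exact: bmfM.
      by rewrite (gE i).2 expr2.
    by move=> y; rewrite mulr_sumr; apply: eq_bigr => i _; rewrite mulrCA.
  have KK : \int[P]_y (K (x, y) ^+ 2) <= 1.
    rewrite -[leRHS](Exp_cst P); apply: Exp_le; [exact: bmfX|exact: bmf_cst|].
    by move=> y; rewrite -real_normK ?num_real// expr_le1.
  have : 0 <= \int[P]_y (K (x, y) - h y) ^+ 2.
    by apply: Exp_ge0 => y; exact: sqr_ge0.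
  rewrite (Exp_eq P (g := fun y => (K (x, y) ^+ 2 - 2 * (K (x, y) * h y)) + h y * h y)).
    rewrite ExpD; [|apply: bmfB; [exact: bmfX|by apply: bmfZ; exact: bmfM]|exact: bmfM].
    rewrite ExpB; [|exact: bmfX|by apply: bmfZ; exact: bmfM].
    by rewrite ExpZ; [rewrite hh Kh; lra|exact: bmfM].
  by move=> y; ring.
have b2 i : bmf (fun x => (l * g i x) ^+ 2) by apply: bmfX; exact: bmfZ.
rewrite -[leRHS](Exp_cst P).
apply: le_trans (Exp_le P (bmf_sum b2) (bmf_cst 1) pw).
rewrite Exp_sum// (eq_bigr (fun=> l ^+ 2)); first by rewrite sumr_const card_ord mulr_natl.
move=> i _; rewrite (Exp_eq P (g := fun x => l ^+ 2 * (g i x * g i x))).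
  by rewrite ExpZ ?gg ?eqxx ?mulr1//; exact: bmfM.
by move=> x; ring.
Qed.

(** Bessel bounds the size of an orthonormal family by [l ^- 2]. One of maximal size spans, since
    otherwise the normalised residual [p] of some [h] could be appended to it. *)
Lemma eigfun_basis : exists m (g : 'I_m -> T -> R), orthonormal_eig g /\
  forall h, eigfun h -> exists c : 'I_m -> R, forall x, h x = \sum_(i < m) c i * g i x.
Proof.
pose Q m := `[< exists g : 'I_m -> T -> R, orthonormal_eig g >].
have Q0 : exists m, Q m.
  exists 0%N; apply/asboolP; exists (fun _ _ => 0).
  by split=> [[]|[]] //.
have Qub m : Q m -> (m <= (Num.trunc (l ^- 2)))%N.
  move=> /asboolP[g /eigfun_bessel ml].
  rewrite truncn_ge_nat ?invr_ge0 ?exprn_ge0 ?(ltW l_gt0)//.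
  by rewrite -ler_pdivlMr ?exprn_gt0// mul1r in ml.
case: (ex_maxnP Q0 Qub) => m /asboolP[g gO] maxm.
exists m, g; split=> // h hE; have [gE gg] := gO; have bg i := (gE i).1.
have bh := hE.1.
pose c i := \int[P]_x (h x * g i x); exists c.
pose p x := h x - \sum_(i < m) c i * g i x.
have pE : eigfun p.
  by apply: eigfunB => //; apply: eigfun_sum => i; exact: eigfunZ.
have bp := pE.1.
have pg i : \int[P]_x (p x * g i x) = 0.
  rewrite (Exp_eq P (g := fun x => h x * g i x - (\sum_(i < m) c i * g i x) * g i x)).
    rewrite ExpB ?Exp_dot_sum ?subrr//; first exact: bmfM.
    by apply: bmfM => //; apply: bmf_sum => j; exact: bmfZ.
  by move=> x; rewrite -mulrBl.
suff p0 : \int[P]_x p x ^+ 2 = 0.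
  by move=> x; apply/eqP; rewrite -subr_eq0; apply/eqP; exact: (eigfun_eq0 pE p0).
apply: contrapT => /eqP p_neq0.
have p_gt0 : 0 < \int[P]_x p x ^+ 2.
  by rewrite lt_def p_neq0 /=; apply: Exp_ge0 => x; exact: sqr_ge0.
set n2 := \int[P]_x p x ^+ 2 in p_gt0.
pose n1 := (Num.sqrt n2)^-1.
have n11 : n1 * n1 * n2 = 1.
  by rewrite -invfM -expr2 sqr_sqrtr ?ltW// mulVf// gt_eqF.
pose g' (i : 'I_m.+1) := if unlift ord_max i is Some j then g j else (fun x => n1 * p x).
suff /maxm : Q m.+1 by rewrite ltnn.
apply/asboolP; exists g'; split=> [i|i j]; rewrite /g'.
  by case: unliftP => [i' _|_] //; exact: eigfunZ.
case: (unliftP ord_max i) => [i' ->|->]; case: (unliftP ord_max j) => [j' ->|->].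
- by rewrite gg (inj_eq lift_inj).
- rewrite (Exp_eq P (g := fun x => n1 * (p x * g i' x))); last by move=> x; ring.
  rewrite ExpZ ?pg ?mulr0; last exact: bmfM.
  by rewrite eq_sym (negbTE (neq_lift _ _)).
- rewrite (Exp_eq P (g := fun x => n1 * (p x * g j' x))); last by move=> x; ring.
  rewrite ExpZ ?pg ?mulr0; last exact: bmfM.
  by rewrite (negbTE (neq_lift _ _)).
- rewrite (Exp_eq P (g := fun x => n1 * n1 * (p x ^+ 2))); last by move=> x; ring.
  by rewrite ExpZ ?n11 ?eqxx//; exact: bmfX.
Qed.

(* The eigenspace of [K] is finite dimensional and invariant under composition
   with [S], so this composition has a complex eigenvector on it. *)
Lemma eigfun_trivial :
  (forall (f : T -> R[i]) (lam : R[i]), cmeasurable f ->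
     (forall x, f (S x) = lam * f x) -> exists c, mu_as P (fun x => f x = c)) ->
  forall h, eigfun h -> forall x, h x = 0.
Proof.
move=> wm h hE; have [m [g [gO gspan]]] := eigfun_basis.
have [gE gg] := gO; have bg i := (gE i).1.
have [c hc] := gspan h hE.
have [m0|m_gt0] := posnP m.
  move=> x; rewrite hc; clear -m0; move: c g; rewrite m0 => c g.
  by rewrite big_ord0.
exfalso.
have /choice[M MP] : forall i, exists c : 'I_m -> R,
    forall x, g i (S x) = \sum_(j < m) c j * g j x.
  by move=> i; apply: gspan; exact: eigfun_shift.
(* The matrix of composition with [S], complexified to have an eigenvalue; a row eigenvector gives
   the coefficients of the eigenfunction [f]. *)
pose A : 'M[R[i]]_m := \matrix_(i, j) (M i j)%:C%C.
have [lam /eigenvalueP[v vA v0]] := eigenvalue_closed A m_gt0.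
pose f x : R[i] := \sum_(i < m) v 0 i * (g i x)%:C%C.
have fS x : f (S x) = lam * f x.
  rewrite /f mulr_sumr.
  under eq_bigr do rewrite MP rmorph_sum mulr_sumr.
  rewrite exchange_big; apply: eq_bigr => j _ /=.
  have := congr1 (fun w : 'rV_m => w 0 j) vA; rewrite !mxE mulrA => <-.
  rewrite mulr_suml; apply: eq_bigr => i _; rewrite !mxE.
  by rewrite rmorphM /= mulrA.
have ReE x : complex.Re (f x) = \sum_(i < m) complex.Re (v 0 i) * g i x.
  rewrite /f raddf_sum; apply: eq_bigr => i _ /=.
  by case: (v 0 i) => a b /=; rewrite mulr0 subr0.
have ImE x : complex.Im (f x) = \sum_(i < m) complex.Im (v 0 i) * g i x.
  rewrite /f raddf_sum; apply: eq_bigr => i _ /=.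
  by case: (v 0 i) => a b /=; rewrite mulr0 add0r.
have Ref : eigfun (fun x => complex.Re (f x)).
  rewrite (_ : (fun x => _) = (fun x => \sum_(i < m) complex.Re (v 0 i) * g i x)).
    by apply: eigfun_sum => i; exact: eigfunZ.
  exact/funext.
have Imf : eigfun (fun x => complex.Im (f x)).
  rewrite (_ : (fun x => _) = (fun x => \sum_(i < m) complex.Im (v 0 i) * g i x)).
    by apply: eigfun_sum => i; exact: eigfunZ.
  exact/funext.
have [|c0 [N [mN N0 fN]]] := wm f lam _ fS.
  by split; [case: Ref => -[]|case: Imf => -[]].
have Nf x : ~ N x -> f x = c0 by move=> Nx; apply: contrapT => /fN.
have Re0 := eigfun_ae_cst (c := complex.Re c0) Ref mN N0 (fun x Nx => congr1 _ (Nf x Nx)).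
have Im0 := eigfun_ae_cst (c := complex.Im c0) Imf mN N0 (fun x Nx => congr1 _ (Nf x Nx)).
(* The real and imaginary parts of [f] vanish, and orthonormality reads the coefficients [v] off
   them, so [v] would be zero. *)
move/eqP: v0; apply; apply/rowP => i; rewrite mxE.
have Rei : complex.Re (v 0 i) = 0.
  rewrite -(Exp_dot_sum (fun i => complex.Re (v 0 i)) i gO).
  rewrite (Exp_eq P (g := fun=> 0)) ?Exp_cst// => x.
  by rewrite -ReE Re0 mul0r.
have Imi : complex.Im (v 0 i) = 0.
  rewrite -(Exp_dot_sum (fun i => complex.Im (v 0 i)) i gO).
  rewrite (Exp_eq P (g := fun=> 0)) ?Exp_cst// => x.
  by rewrite -ImE Im0 mul0r.
by move: Rei Imi; case: (v 0 i) => a b /= -> ->.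
Qed.

End Eigenspace.

(** * Null sets and almost surely constant functions *)

Section AlmostSurelyConstant.
Context {R : realType} {d : measure_display} {T : measurableType d}.
Variable P : probability T R.

Lemma measurable_superlevel (h : T -> R) t : measurable_fun setT h ->
  measurable [set x | t < h x].
Proof.
move=> mh; have := mh measurableT `]t, +oo[%classic (measurable_itv _).
rewrite setTI; congr measurable; apply/seteqP.
by split=> x /=; rewrite in_itv /= andbT.
Qed.

Lemma measurable_neq (h : T -> R) a : measurable_fun setT h ->
  measurable [set x | h x != a].
Proof.
move=> mh; have := mh measurableT (~` [set a]) (measurableC (measurable_set1 a)).
by rewrite setTI; congr measurable; apply/seteqP; split=> x /= /eqP.
Qed.

Lemma prob_null_bigcup (F : nat -> set T) : (forall n, measurable (F n)) ->
  (forall n, P (F n) = 0%E) -> P (\bigcup_n F n) = 0%E.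
Proof.
move=> mF F0; apply: (negligibleP P (bigcupT_measurable _ mF)).1.
by apply: negligible_bigcup => n; exact: (negligibleP P (mF n)).2 (F0 n).
Qed.

Lemma prob_null_setU (A B : set T) : measurable A -> measurable B ->
  P A = 0%E -> P B = 0%E -> P (A `|` B) = 0%E.
Proof.
move=> mA mB A0 B0; apply: (negligibleP P (measurableU _ _ mA mB)).1.
by apply: negligibleU; [exact: (negligibleP P mA).2|exact: (negligibleP P mB).2].
Qed.

Lemma prob_fin_num (A : set T) : measurable A -> P A \is a fin_num.
Proof. exact: fin_num_measure. Qed.

Lemma prob_null_sub (A B : set T) : measurable A -> measurable B -> A `<=` B ->
  P B = 0%E -> P A = 0%E.
Proof. by move=> mA mB AB B0; exact: subset_measure0 AB B0. Qed.

Lemma prob_null_setC (A : set T) : measurable A -> P A = 0%E -> P (~` A) = 0%E ->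
  False.
Proof.
move=> mA A0 /eqP; rewrite probability_setC// A0 sube0.
by rewrite eqe oner_eq0.
Qed.

Lemma prob_eq1 (A : set T) : measurable A -> P (~` A) = 0%E -> P A = 1%E.
Proof.
move=> mA A0; rewrite -[A]setCK probability_setC ?A0 ?sube0//.
exact: measurableC.
Qed.

(** The constant is the supremum of the levels that [h] exceeds almost surely. This set of levels is
    nonempty and bounded because [h] is finite everywhere. *)
Lemma ae_cst_of_01 (h : T -> R) : measurable_fun setT h ->
  (forall t, P [set x | t < h x] = 0%E \/ P (~` [set x | t < h x]) = 0%E) ->
  exists c, P [set x | h x != c] = 0%E.
Proof.
move=> mh h01; pose A t := [set x | t < h x].
have mA t : measurable (A t) by exact: measurable_superlevel.
have mAC t : measurable (~` A t) by exact: measurableC.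
pose U := [set t | P (~` A t) = 0%E].
have hasU : U !=set0.
  apply: contrapT => U0.
  apply: (@prob_null_setC setT) => //; last by rewrite setCT measure0.
  rewrite (_ : setT = \bigcup_n A (- n%:R)).
    apply: prob_null_bigcup => // n; have [//|hn] := h01 (- n%:R).
    by exfalso; apply: U0; exists (- n%:R).
  apply/seteqP; split=> // x _; exists (Num.truncn `|h x|).+1 => //=.
  rewrite /A /= ltrNl (le_lt_trans (ler_norm _))// normrN.
  by have /andP[] := truncn_itv (normr_ge0 (h x)).
have [n An] : exists n, P (A n%:R) = 0%E.
  apply: contrapT => Un.
  apply: (@prob_null_setC setT) => //; last by rewrite setCT measure0.
  rewrite (_ : setT = \bigcup_n ~` A n%:R).
    apply: prob_null_bigcup => // n; have [hn|//] := h01 n%:R.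
    by exfalso; apply: Un; exists n.
  apply/seteqP; split=> // x _; exists (Num.truncn `|h x|).+1 => //=.
  apply/negP; rewrite -leNgt (le_trans (ler_norm _))// ltW//.
  by have /andP[] := truncn_itv (normr_ge0 (h x)).
have ubU : ubound U n%:R.
  move=> t Ut; rewrite leNgt; apply/negP => tn.
  apply: (prob_null_setC (mA t)) => //; apply: prob_null_sub An => // x /=.
  by rewrite /A /=; exact: lt_trans.
have supU : has_sup U by split=> //; exists n%:R.
pose c := sup U; exists c.
have eps m : 0 < m.+1%:R^-1 :> R by rewrite invr_gt0.
rewrite (_ : [set x | h x != c] =
  \bigcup_m (~` A (c - m.+1%:R^-1) `|` A (c + m.+1%:R^-1))); last first.
  apply/seteqP; split=> [x /= hc|x [m _ [/=|/=]]].
  - have /ltr_add_invr[m hm] : 0 < `|h x - c| by rewrite normr_gt0 subr_eq0.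
    rewrite add0r in hm; exists m => //=; rewrite /A /=.
    have [hxc|hxc] := leP c (h x).
      by right; move: hm; rewrite ger0_norm ?subr_ge0// ltrBrDl.
    by left; apply/negP; rewrite -leNgt lerBrDr -lerBrDl; move: hm;
      rewrite ltr0_norm ?subr_lt0// opprB => /ltW.
  - rewrite /A /= => /negP; rewrite -leNgt => h1; apply: contraTneq h1 => ->.
    by rewrite -ltNge ltrBlDr ltrDl.
  - rewrite /A /= => h1; apply: contraTneq h1 => ->.
    by rewrite -leNgt lerDl ltW.
apply: prob_null_bigcup => m; first exact: measurableU.
apply: prob_null_setU => //.
- have [u Uu cu] := sup_adherent (eps m) supU.
  apply: prob_null_sub Uu => // x /=; rewrite /A /= => /negP; rewrite -leNgt => hx.
  by apply/negP; rewrite -leNgt (le_trans hx)// ltW.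
- have [//|hn] := h01 (c + m.+1%:R^-1).
  have : c + m.+1%:R^-1 <= sup U by apply: ub_le_sup => //; exists n%:R.
  by rewrite -/c gerDl leNgt eps.
Qed.

End AlmostSurelyConstant.

(** Phrased through null sets only, this passes between a capacity and a measure with the same null
    sets. *)
Definition null_ergodic {R : realType} {d} {T : measurableType d} (S : T -> T)
    (mu : set T -> \bar R) :=
  forall B, measurable B -> S @^-1` B = B -> mu B = 0%E \/ mu (~` B) = 0%E.

(** * Ergodicity of the product of two invariant probabilities *)

Section ProductErgodic.
Context {R : realType} {d d' : measure_display} {T : measurableType d}
  {T' : measurableType d'}.
Variables (Q : probability T R) (Q' : probability T' R).
Variables (S : T -> T) (S' : T' -> T').
Hypotheses (mS : measurable_fun setT S) (mS' : measurable_fun setT S').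
Hypotheses (QS : cap_invariant S Q) (QS' : cap_invariant S' Q').
Hypothesis ergQ' : null_ergodic S' Q'.
Hypothesis noeig : forall (f : T -> R[i]) (lam : R[i]), cmeasurable f ->
  (forall x, f (S x) = lam * f x) -> exists c, mu_as Q (fun x => f x = c).

(** Superlevel sets of [G] are invariant, so [G] is almost surely a constant [c] and its square
    integrates to [c] times its mean. *)
Lemma invariant_mean0 (G : T' -> R) : bmf G -> (forall z, G (S' z) = G z) ->
  \int[Q']_z G z = 0 -> \int[Q']_z G z ^+ 2 = 0.
Proof.
move=> bG GS G0; have mG := bG.1.
have [t|c Gc] := @ae_cst_of_01 _ _ _ Q' G mG.
  apply: ergQ'; first exact: measurable_superlevel.
  by apply/seteqP; split=> z /=; rewrite GS.
have mN : measurable [set z | G z != c] by exact: measurable_neq.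
rewrite (Exp_ae_eq (P := Q') (g := fun x => c * G x) _ _ mN Gc).
- by rewrite ExpZ// G0 mulr0.
- exact: bmfX.
- exact: bmfZ.
- by move=> x /= /negP; rewrite negbK => /eqP {1}<-; rewrite expr2.
Qed.

Variable B : set (T * T').
Hypotheses (mB : measurable B) (BS : prod_map S S' @^-1` B = B).

Let c := fine ((Q \x Q')%E B).
Let F : T * T' -> R := fun z => \1_B z - c.

Let c01 : 0 <= c <= 1.
Proof.
apply/andP; split; first by rewrite fine_ge0.
rewrite -lee_fin fineK; last exact: (prob_fin_num (Q \x Q')%E).
exact: (probability_le1 (Q \x Q')%E mB).
Qed.

Let bF : bmf F.
Proof. by apply: bmfB; [exact: bmf_indic|exact: bmf_cst]. Qed.

Let F1 z : `|F z| <= 1.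
Proof.
have /andP[c0 c1] := c01.
by rewrite /F indicE ler_norml; case: (_ \in _); rewrite /= ?mulr1n ?mulr0n;
  apply/andP; split; lra.
Qed.

Let FS x z : F (S x, S' z) = F (x, z).
Proof.
rewrite /F !indicE; congr (_%:R - _); congr (nat_of_bool _).
by apply/asbool_equiv_eq; rewrite -{2}BS.
Qed.

Let F0 : \int[(Q \x Q')%E]_z F z = 0.
Proof.
rewrite /F ExpB; [|exact: bmf_indic|exact: bmf_cst].
by rewrite Exp_cst Exp_indic// subrr.
Qed.

Let k := kmul Q' F (ktr F).

Let bk : bmf k.
Proof. by apply: bmf_kmul => //; exact: bmf_ktr. Qed.

Let ksymm : ktr k = k.
Proof.
by apply/funext => -[x y]; apply: Exp_eq => z /=; rewrite mulrC.
Qed.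

Let k1 z : `|k z| <= 1.
Proof.
apply: Exp_norm_le.
  by apply: bmfM; [exact: bmf_sec2|exact: (bmf_sec2 z.2 bF)].
by move=> w; rewrite normrM mulr_ile1 ?F1 //; exact: F1.
Qed.

Let kS x y : k (S x, S y) = k (x, y).
Proof.
rewrite /k /kmul /ktr /=.
rewrite -(Exp_inv mS' QS' (f := fun w => F (S x, w) * F (S y, w))).
  by apply: Exp_eq => w; rewrite !FS.
by apply: bmfM; exact: bmf_sec2.
Qed.

(** Integrating over [x] first leaves the function [G], invariant under [S'] and of mean zero, hence
    null by ergodicity of [Q']. *)
Let kmean0 y : \int[Q]_x k (x, y) = 0.
Proof.
have bFF : bmf (fun u : T * T' => F u * F (y, u.2)).
  by apply: bmfM => //; apply: bmf_comp => //; mproj.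
rewrite /k /kmul /ktr /= (Exp_swap Q Q' bFF) /=.
pose G z := \int[Q]_x F (x, z).
have bG : bmf G by exact: bmf_int1.
rewrite (Exp_eq Q' (g := fun z => G z * F (y, z))); last first.
  by move=> z; rewrite ExpZr//; exact: bmf_sec1.
apply: Exp_sqr_eq0 => //; first exact: bmf_sec2.
apply: invariant_mean0 => //; last by rewrite -F0 /G (Exp_prod21 Q Q').
move=> z; rewrite /G -(Exp_inv mS QS (f := fun x => F (x, S' z))).
  by apply: Exp_eq => x; rewrite FS.
exact: bmf_sec1.
Qed.

Let kdot_k0 : kdot Q Q k k = 0.
Proof.
apply/eqP; apply: contrapT => /negP kk0.
have t2 : 0 < kdot Q Q k k by rewrite lt_def kk0 kdot_ge0.
have bkF : bmf (kmul Q k F) by exact: bmf_kmul.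
have bkk : bmf (kmul Q k k) by exact: bmf_kmul.
have sqr_pos (x a b : R) : 0 < x -> x ^+ 2 <= a * b -> 0 <= a -> 0 <= b -> 0 < b.
  move=> x0 xab a0 b0; rewrite lt_def b0 andbT; apply/eqP => b00.
  by move: xab; rewrite b00 mulr0 leNgt exprn_gt0.
(* As [k] is [F] composed with its adjoint, the squared norm of [k] is the inner product of [F] with
   [k F], so [k F] is not null. The same argument then shows that [k] squared is not null. *)
have t3 : 0 < kdot Q Q' (kmul Q k F) (kmul Q k F).
  apply: (sqr_pos (kdot Q Q k k) (kdot Q Q' F F)) => //; [|exact: kdot_ge0..].
  rewrite {1}/k kdot_adjoint//; last exact: bmf_ktr.
  have -> : ktr (ktr F) = F by apply/funext => -[].
  exact: kdot_CS.
have t4 : 0 < kdot Q Q (kmul Q k k) (kmul Q k k).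
  apply: (sqr_pos _ (kdot Q Q k k) _ t3); [|exact: kdot_ge0..].
  rewrite kdot_adjoint//.
  have -> : kmul Q' (kmul Q k F) (ktr F) = kmul Q k k.
    by rewrite kmulA//; exact: bmf_ktr.
  exact: kdot_CS.
have [l [g [l0 bg [x gx0] gE]]] := kernel_eigenfunction bk ksymm k1 t2 t4.
have kk1 z : `|kmul Q k k z| <= 1.
  apply: Exp_norm_le; first by apply: bmfM; [exact: bmf_sec2|exact: bmf_sec1].
  by move=> w; rewrite normrM mulr_ile1 ?k1.
have kkS u v : kmul Q k k (S u, S v) = kmul Q k k (u, v).
  rewrite /kmul /= -(Exp_inv mS QS (f := fun w => k (S u, w) * k (w, S v))).
    by apply: Exp_eq => w; rewrite !kS.
  by apply: bmfM; [exact: bmf_sec2|exact: bmf_sec1].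
have kkmean0 y : \int[Q]_x kmul Q k k (x, y) = 0.
  have bkk2 : bmf (fun z : T * T => k z * k (z.2, y)).
    by apply: bmfM => //; apply: bmf_comp => //; mproj.
  rewrite /kmul /= (Exp_swap Q Q bkk2) /= (Exp_eq Q (g := fun=> 0)) ?Exp_cst// => w.
  by rewrite ExpZr ?kmean0 ?mul0r//; exact: bmf_sec1.
have gE' : eigfun Q (kmul Q k k) l g by split.
by move/eqP: gx0; apply; exact: (eigfun_trivial mS QS bkk kk1 kkS kkmean0 l0 noeig gE').
Qed.

(** The function [u] has squared norm equal to the integral of [k] over the square of [A], which is
    zero; so [u] is orthogonal to the indicator of [A']. *)
Let F_rect A A' : measurable A -> measurable A' ->
  \int[(Q \x Q')%E]_z (F z * (\1_A z.1 * \1_A' z.2)) = 0.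
Proof.
move=> mA mA'; have bA : bmf (\1_A : T -> R) by exact: bmf_indic.
have bA' : bmf (\1_A' : T' -> R) by exact: bmf_indic.
have bFA : bmf (fun z : T * T' => F z * \1_A z.1).
  by apply: bmfM => //; apply: bmf_comp => //; mproj.
have bb : bmf (fun z : T * T' => F z * (\1_A z.1 * \1_A' z.2)).
  by apply: bmfM => //; apply: bmfM; apply: bmf_comp => //; mproj.
rewrite -(Exp_prod21 Q Q' bb) /=.
pose u z := \int[Q]_x (F (x, z) * \1_A x).
have bu : bmf u by exact: (bmf_int1 Q bFA).
rewrite (Exp_eq Q' (g := fun z => u z * \1_A' z)); last first.
  move=> z; rewrite -ExpZr; last exact: (bmf_sec1 z bFA).
  by apply: Exp_eq => x; rewrite mulrA.
apply: Exp_sqr_eq0 => //.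
have bFAu : bmf (fun z : T * T' => F z * \1_A z.1 * u z.2).
  by apply: bmfM => //; apply: bmf_comp => //; mproj.
transitivity (\int[Q']_z \int[Q]_x (F (x, z) * \1_A x * u z)).
  by apply: Exp_eq => z; rewrite expr2 -ExpZr//; exact: (bmf_sec1 z bFA).
rewrite -(Exp_swap Q Q' bFAu).
have bkA : bmf (fun z : T * T => k z * (\1_A z.1 * \1_A z.2)).
  by apply: bmfM => //; apply: bmfM; apply: bmf_comp => //; mproj.
transitivity (\int[Q]_x \int[Q]_y (k (x, y) * (\1_A x * \1_A y))).
  apply: Exp_eq => x /=.
  transitivity (\int[Q']_z \int[Q]_y (F (x, z) * \1_A x * (F (y, z) * \1_A y))).
    by apply: Exp_eq => z; rewrite -ExpZ//; exact: (bmf_sec1 z bFA).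
  rewrite (Exp_swap Q' Q (f := fun z : T' * T =>
      F (x, z.1) * \1_A x * (F (z.2, z.1) * \1_A z.2))).
    apply: Exp_eq => y; rewrite -ExpZr; last first.
      by apply: bmfM; [exact: bmf_sec2|exact: (bmf_sec2 y bF)].
    by apply: Exp_eq => z; rewrite /ktr /=; ring.
  apply: bmfM; apply: bmfM; do ?exact: bmf_cst; apply: bmf_comp => //; by mproj.
rewrite (Exp_prod12 Q Q bkA); apply: Exp_sqr_eq0 => //.
by apply: bmfM; apply: bmf_comp => //; mproj.
Qed.

Let prod_rect A A' : measurable A -> measurable A' ->
  ((Q \x Q') ((A `*` A') `&` B) = c%:E * (Q A * Q' A'))%E.
Proof.
move=> mA mA'; have mAA : measurable (A `*` A') by exact: measurableX.
have mAAB : measurable ((A `*` A') `&` B) by exact: measurableI.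
rewrite -product_measure1E//.
rewrite -[LHS]fineK ?(prob_fin_num (Q \x Q')%E)//.
rewrite -[X in (_ * X)%E]fineK ?(prob_fin_num (Q \x Q')%E)//.
rewrite -EFinM; congr EFin; rewrite -!Exp_indic//.
rewrite -ExpZ; last exact: bmf_indic.
apply/eqP; rewrite -subr_eq0 -ExpB; [|exact: bmf_indic|by apply: bmfZ; exact: bmf_indic].
apply/eqP; rewrite -[RHS](F_rect mA mA'); apply: Exp_eq => -[x z].
rewrite /F !indicE in_setI in_setX /=.
by case: (x \in A); case: (z \in A'); case: (_ \in B) => /=; ring.
Qed.

(** When [c] is nonzero, the normalised restriction of the product measure to [B] agrees with it on
    rectangles, hence everywhere; but it vanishes on the complement of [B]. *)
Theorem noeig_prod_ergodic : (Q \x Q')%E B = 0%E \/ (Q \x Q')%E (~` B) = 0%E.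
Proof.
have [c0|c0] := eqVneq c 0.
  by left; rewrite -[LHS]fineK ?(prob_fin_num (Q \x Q')%E)// -/c c0.
right; have ci0 : 0 <= c^-1 by rewrite invr_ge0; case/andP: c01.
pose m := mscale (NngNum ci0) (mrestr (Q \x Q')%E mB).
rewrite (@product_measure_unique _ _ _ _ _ Q Q' m).
- suff : ((c^-1)%:E * (Q \x Q') (~` B `&` B) = 0)%E by [].
  by rewrite setICl measure0 mule0.
- move=> A A' mA mA'.
  suff : ((c^-1)%:E * (Q \x Q') ((A `*` A') `&` B) = Q A * Q' A')%E by [].
  by rewrite prod_rect// muleA -EFinM mulVf// mul1e.
- exact: measurableC.
Qed.

End ProductErgodic.

(** * Continuity from above of upper probabilities *)

Section UpperContinuity.
Context {R : realType} {d : measure_display} {T : measurableType d}.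
Variable V : set T -> \bar R.
Hypothesis upV : upper_probability V.
Local Open Scope ereal_scope.

Lemma upper_core : exists P : probability T R, core V P.
Proof.
have [_ [Lam [_ LamV]]] := upV.
have [[P LP _] _] := LamV setT measurableT.
exists P; split=> //; first exact: probability_setT.
  by move=> A B mA mB AB; rewrite measureU.
by move=> A mA; exact: (LamV A mA).2.
Qed.

Lemma upper_coreP A : measurable A -> exists2 P : probability T R, core V P & V A = P A.
Proof.
move=> mA; have [_ [Lam [_ LamV]]] := upV.
have [[P LP VP] _] := LamV A mA; exists P => //.
split=> //; first exact: probability_setT.
  by move=> B C mB mC BC; rewrite measureU.
by move=> B mB; exact: (LamV B mB).2.
Qed.

Lemma upper_ge0 A : measurable A -> 0 <= V A.
Proof. by move=> /upper_coreP[P _ ->]. Qed.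

Lemma upper_le1 A : measurable A -> V A <= 1.
Proof. by move=> mA; have [P _ ->] := upper_coreP mA; exact: probability_le1. Qed.

Lemma upper_fin A : measurable A -> V A \is a fin_num.
Proof. by move=> mA; have [P _ ->] := upper_coreP mA; exact: fin_num_measure. Qed.

(* A cluster point of maximising measures for the [A n] gives, by setwise
   compactness, a single measure bounding all of them. *)
Lemma upper_bigcap (A : nat -> set T) (e : \bar R) :
  (forall n, measurable (A n)) -> nonincreasing_seq A ->
  (forall n, e <= V (A n)) -> e <= V (\bigcap_n A n).
Proof.
move=> mA ndA eA; have [_ [Lam [cLam LamV]]] := upV.
have mI : measurable (\bigcap_n A n) by exact: bigcapT_measurable.
have /choice[p pP] : forall n, exists P, Lam P /\ V (A n) = P (A n).
  by move=> n; have [[P ? ?] _] := LamV (A n) (mA n); exists P.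
pose f n := setwise (p n).
have [|_ [[P LP <-] clP]] := cLam (f @ \oo) _.
  by exists 0%N => // n _; exists (p n) => //; exact: (pP n).1.
have PA m : e <= P (A m).
  rewrite leNgt; apply/negP => Pe.
  have setwiseE (P' : probability T R) : setwise P' (A m) = P' (A m).
    by rewrite /setwise asboolT.
  (* If [P (A m) < e], clustering gives some [n >= m] with [p n (A m) < e], whereas
     [e <= V (A n) = p n (A n) <= p n (A m)]. *)
  have [] := clP [set g | exists2 n, (m <= n)%N & g = f n]
                 [set g | g (A m) < e].
  - by exists m => // n /= mn; exists n.
  - have := @proj_continuous (set T) (fun=> \bar R) (A m) (setwise P).
    move=> /(_ [set u | u < e]); apply; apply: open_ereal_lt'.
    by have : setwise P (A m) < e by rewrite setwiseE.
  move=> _ [[n mn ->]] /=; rewrite /f setwiseE ltNge => /negP; apply.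
  apply: (le_trans (eA n)); rewrite (pP n).2; apply: le_measure; rewrite ?inE//.
  exact/subsetPset/ndA.
apply: (@le_trans _ _ (P (\bigcap_n A n))); last exact: (LamV _ mI).2.
have c := @nonincreasing_cvg_mu _ _ _ P A _ mA mI ndA.
apply: (cvge_to_ge (c _)); first by rewrite (le_lt_trans (probability_le1 _ _))// ltry.
by near=> n; exact: PA.
Unshelve. all: by end_near. Qed.

End UpperContinuity.

(** * Limits of bounded sequences along an ultrafilter *)

Section BanachLimit.
Context {R : realType}.

Lemma ultra_bounded_cvg (U : set_system nat) (u : nat -> R) (a b : R) :
  UltraFilter U -> (forall n, a <= u n <= b) -> exists l : R, u n @[n --> U] --> l.
Proof.
move=> UU uab; have cab := @segment_compact R a b.
have [|l [_ lU]] := cab (u @ U) _.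
  by apply: (@filterS _ U _ setT) => [n _ /=|]; [rewrite in_itv /= uab|exact: filterT].
exists l => B Bl; have [//|UB] := in_ultra_setVsetC (u @^-1` B) UU.
by have [x [] /=] := lU (~` B) B UB Bl.
Qed.

End BanachLimit.

(** * From finite to countable additivity *)

Section ProbabilityOfAdditive.
Context {R : realType} {d : measure_display} {T : measurableType d}.
Variable q : set T -> R.
Hypothesis q_ge0 : forall A, 0 <= q A.
Hypothesis q1 : q setT = 1.
Hypothesis qD : forall A B, measurable A -> measurable B -> A `&` B = set0 ->
  q (A `|` B) = q A + q B.
Hypothesis q_cont0 : forall A : nat -> set T, (forall n, measurable (A n)) ->
  nonincreasing_seq A -> \bigcap_n A n = set0 ->
  forall e, 0 < e -> exists n, q (A n) <= e.

Definition additive_prob : set T -> \bar R := fun A => (q A)%:E.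

Let q0 : q set0 = 0.
Proof.
have := qD measurable0 measurable0 (setI0 set0); rewrite setU0.
by move: (q set0) => x h; lra.
Qed.

Let measure0_additive : additive_prob set0 = 0%E.
Proof. by rewrite /additive_prob q0. Qed.

Let measure_ge0_additive A : (0 <= additive_prob A)%E.
Proof. by rewrite lee_fin. Qed.

(** The partial sums differ from the value of the union by [q (A n)], where the tails [A n] decrease
    to the empty set. *)
Let sigma_additive_additive : semi_sigma_additive additive_prob.
Proof.
move=> F mF tF mUF.
pose A n := \bigcup_(i in [set i | (n <= i)%N]) F i.
have mA n : measurable (A n) by apply: bigcup_measurable => i _; exact: mF.
have AS n : A n = F n `|` A n.+1.
  apply/seteqP; split=> [x [i /= ni Fi]|x [Fx|[i /= ni Fi]]].
  - move: ni; rewrite leq_eqVlt => /predU1P[->|ni]; first by left.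
    by right; exists i.
  - by exists n => /=.
  - by exists i => //=; exact: ltnW.
have FA n : F n `&` A n.+1 = set0.
  apply/seteqP; split=> // x [Fx [i /= ni Fi]].
  have := tF n i I I; move=> /(_ (ex_intro _ x (conj Fx Fi))) nE.
  by move: ni; rewrite nE ltnn.
have sumE n : \sum_(0 <= i < n) q (F i) = q (\bigcup_i F i) - q (A n).
  elim: n => [|n IH].
    rewrite big_nil (_ : \bigcup_i F i = A 0%N) ?subrr//.
    by apply/seteqP; split=> x [i _ Fi]; exists i.
  by rewrite big_nat_recr//= IH (AS n) qD//; ring.
have ndA : nonincreasing_seq A.
  by apply/nonincreasing_seqP => n; apply/subsetPset; rewrite (AS n); right.
have A0 : \bigcap_n A n = set0.
  apply/seteqP; split=> // x Ax; have [i _ Fi] := Ax 0%N I.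
  have [j /= ij Fj] := Ax i.+1 I.
  have := tF i j I I; move=> /(_ (ex_intro _ x (conj Fi Fj))) nE.
  by move: ij; rewrite nE ltnn.
have qmono n m : (n <= m)%N -> q (A m) <= q (A n).
  elim: m => [|m IH]; first by rewrite leqn0 => /eqP ->.
  rewrite leq_eqVlt => /predU1P[->//|/IH]; apply: le_trans.
  by rewrite (AS m) qD// lerDr.
have -> : (fun n => \sum_(0 <= i < n) additive_prob (F i)) =
    (fun n => (q (\bigcup_i F i) - q (A n))%:E).
  by apply/funext => n; rewrite /additive_prob sumEFin sumE.
apply: cvg_EFin; first by apply: nearW.
apply/cvgrPdist_le => e e0; have [N HN] := q_cont0 mA ndA A0 e0.
near=> n; rewrite /= opprB addrC subrK ger0_norm//.
by rewrite (le_trans _ HN)// qmono//; near: n; exact: nbhs_infty_ge.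
Unshelve. all: by end_near. Qed.

HB.instance Definition _ := isMeasure.Build _ _ _ additive_prob
  measure0_additive measure_ge0_additive sigma_additive_additive.

Let additive_prob_setT : additive_prob setT = 1%E.
Proof. by rewrite /additive_prob q1. Qed.

HB.instance Definition _ :=
  Measure_isProbability.Build _ _ _ additive_prob additive_prob_setT.

Lemma additive_probability : exists Q : probability T R, forall A, Q A = (q A)%:E.
Proof. by exists additive_prob. Qed.

End ProbabilityOfAdditive.

(** * Points visiting a set infinitely often *)

Section InfinitelyOften.
Context {d : measure_display} {T : measurableType d}.
Variable S : T -> T.
Hypothesis mS : measurable_fun setT S.

Lemma measurable_iter n : measurable_fun setT (iter n S).
Proof.
elim: n => [|n IH]; first exact: measurable_id.
exact: (measurableT_comp mS IH).
Qed.

Lemma measurable_iter_preimage n A : measurable A -> measurable (iter n S @^-1` A).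
Proof. by move=> mA; rewrite -[X in measurable X]setTI; exact: measurable_iter. Qed.

(** The limsup of the preimages of [A]. It is exactly invariant, not just up to a null set, as the
    definition of ergodicity requires. *)
Definition inf_often (A : set T) : set T :=
  \bigcap_N \bigcup_(n in [set n | (N <= n)%N]) (iter n S @^-1` A).

Lemma measurable_inf_often A : measurable A -> measurable (inf_often A).
Proof.
move=> mA; apply: bigcapT_measurable => N; apply: bigcup_measurable => n _.
exact: measurable_iter_preimage.
Qed.

Lemma inf_often_invariant A : S @^-1` (inf_often A) = inf_often A.
Proof.
apply/seteqP; split=> x /= xA N _.
  have [n /= Nn An] := xA N I; exists n.+1 => /=; first exact: leqW.
  by rewrite /preimage /= -iterS iterSr.
have [[//|n] /= Nn An] := xA N.+1 I; exists n => //=.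
by rewrite /preimage /= -iterSr.
Qed.

End InfinitelyOften.

Lemma cap_invariant_iter {R : realType} {d} {T : measurableType d} (S : T -> T)
    (mu : set T -> \bar R) (mS : measurable_fun setT S) (muS : cap_invariant S mu)
    n A :
  measurable A -> mu (iter n S @^-1` A) = mu A.
Proof.
move=> mA; elim: n => // n IH.
rewrite -[RHS]IH -(muS _ (measurable_iter_preimage mS n mA)); congr mu.
by apply/seteqP; split=> x; rewrite /preimage /= -iterS iterSr.
Qed.

(** * An invariant measure in the core *)

Section InvariantCore.
Context {R : realType} {d : measure_display} {T : measurableType d}.
Variables (V : set T -> \bar R) (S : T -> T).
Hypotheses (upV : upper_probability V) (mS : measurable_fun setT S).
Hypothesis VS : cap_invariant S V.

Lemma invariant_core : exists2 Q : probability T R, core V Q & cap_invariant S Q.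
Proof.
have [P [P1 P0 PD PV]] := upper_core upV.
have mI n A : measurable A -> measurable (iter n S @^-1` A).
  exact: measurable_iter_preimage.
pose a i A := fine (P (iter i S @^-1` A)).
(* Since [V] is invariant, it dominates every image of [P] under an iterate of [S], hence the
   averages and their limit. *)
have aV i A : measurable A -> a i A <= fine (V A).
  move=> mA; rewrite -(cap_invariant_iter mS VS i mA); apply: fine_le.
  - exact: prob_fin_num (mI _ _ mA).
  - exact: upper_fin (mI _ _ mA).
  - exact: PV (mI _ _ mA).
have V1 A : measurable A -> fine (V A) <= 1.
  by move=> mA; rewrite -lee_fin fineK ?upper_fin// upper_le1.
have a0 i A : 0 <= a i A by exact: fine_ge0.
have a1 i A : measurable A -> a i A <= 1.
  by move=> mA; exact: le_trans (aV _ _ mA) (V1 _ mA).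
pose avg n A := n.+1%:R^-1 * \sum_(i < n.+1) a i A.
have avg_ge0 n A : 0 <= avg n A by rewrite mulr_ge0// sumr_ge0.
have avg_le n A c : (forall i, a i A <= c) -> avg n A <= c.
  move=> ac; rewrite /avg mulrC ler_pdivrMr//.
  apply: (@le_trans _ _ (\sum_(i < n.+1) c)); first by apply: ler_sum => i _.
  by rewrite sumr_const card_ord mulr_natr.
have [U [UU oU]] := ultraFilterLemma eventually_filter.
(* The default value 0 off the measurable sets makes [q] nonnegative on all sets. *)
have /choice[q qP] : forall A, exists l : R,
    (measurable A -> avg n A @[n --> U] --> l) /\ (~ measurable A -> l = 0).
  move=> A; have [mA|mA] := pselect (measurable A); last by exists 0.
  have [|l lP] := @ultra_bounded_cvg R U (fun n => avg n A) 0 1 UU.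
    by move=> n; rewrite avg_ge0 avg_le// => i; exact: a1.
  by exists l.
have qC A : measurable A -> avg n A @[n --> U] --> q A by case: (qP A).
have q0 A : 0 <= q A.
  have [mA|mA] := pselect (measurable A); last by rewrite (qP A).2.
  by apply: (cvgr_to_ge (qC A mA)); apply: nearW => n.
have qV A : measurable A -> q A <= fine (V A).
  move=> mA; apply: (cvgr_to_le (qC A mA)); apply: nearW => n.
  by apply: avg_le => i; exact: aV.
have q1 : q setT = 1.
  apply: (cvg_unique _ (qC setT measurableT)) => //.
  rewrite (_ : (fun n => avg n setT) = fun=> 1); first exact: cvg_cst.
  apply/funext => n; rewrite /avg (eq_bigr (fun=> 1)).
    by rewrite sumr_const card_ord mulVf.
  by move=> i _; rewrite /a preimage_setT [X in fine X]P1.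
have qD A B : measurable A -> measurable B -> A `&` B = set0 -> q (A `|` B) = q A + q B.
  move=> mA mB AB; apply: (cvg_unique _ (qC _ (measurableU _ _ mA mB))) => //.
  rewrite (_ : (fun n => avg n (A `|` B)) = (fun n => avg n A + avg n B)).
    by apply: cvgD; exact: qC.
  apply/funext => n; rewrite /avg -mulrDr -big_split; congr (_ * _).
  apply: eq_bigr => i _; rewrite /a preimage_setU PD ?fineD//.
  - exact: prob_fin_num (mI _ _ mA).
  - exact: prob_fin_num (mI _ _ mB).
  - exact: mI.
  - exact: mI.
  - by rewrite -preimage_setI AB preimage_set0.
have qcont (A : nat -> set T) : (forall n, measurable (A n)) ->
    nonincreasing_seq A -> \bigcap_n A n = set0 ->
    forall e, 0 < e -> exists n, q (A n) <= e.
  move=> mA ndA A0 e e0; apply: contrapT => /forallNP qe.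
  have : (e%:E <= V (\bigcap_n A n))%E.
    apply: upper_bigcap => // n; rewrite -[V _]fineK ?upper_fin// lee_fin.
    by rewrite (le_trans _ (qV _ (mA n)))// ltW// ltNge; exact/negP.
  by rewrite A0; have [[-> _ _] _] := upV; rewrite lee_fin leNgt e0.
have [Q QE] := additive_probability q0 q1 qD qcont.
exists Q; first split.
- exact: probability_setT.
- by [].
- by move=> A B mA mB AB; rewrite measureU.
- by move=> A mA; rewrite QE -[V A]fineK ?upper_fin// lee_fin qV.
move=> A mA; rewrite !QE; congr EFin.
have mSA : measurable (S @^-1` A) by exact: (mI 1%N).
apply/eqP; rewrite -subr_eq0 -normr_le0; apply/ler_addgt0Pl => e e0; rewrite addr0.
have cD : `|avg n (S @^-1` A) - avg n A| @[n --> U] --> `|q (S @^-1` A) - q A|.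
  by apply: cvg_norm; apply: cvgB; exact: qC.
apply: (cvgr_to_le cD); apply: oU; near=> n.
(* The averages telescope, leaving a difference of at most 1 divided by [n.+1]. *)
have -> : avg n (S @^-1` A) - avg n A = n.+1%:R^-1 * (a n.+1 A - a 0%N A).
  rewrite /avg -mulrBr; congr (_ * _).
  rewrite (eq_bigr (fun i : 'I_n.+1 => a i.+1 A)) => [|i _]; last first.
    by rewrite /a; congr (fine (P _)).
  rewrite -(big_mkord xpredT (fun i => a i.+1 A)) -(big_mkord xpredT (fun i => a i A)).
  by rewrite -sumrB telescope_sumr.
rewrite normrM gtr0_norm ?invr_gt0// mulrC ler_pdivrMr//.
apply: (@le_trans _ _ 1).
  have := a1 n.+1 A mA; have := a1 0%N A mA; have := a0 n.+1 A; have := a0 0%N A.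
  by move=> h1 h2 h3 h4; rewrite ler_norml; lra.
rewrite -ler_pdivrMl// mulr1; apply: (@le_trans _ _ n%:R); last by rewrite ler_nat.
near: n; exact: nbhs_infty_ger.
Unshelve. all: by end_near. Qed.

Lemma ergodic_core : null_ergodic S V ->
  exists Q : probability T R, [/\ core V Q, cap_invariant S Q &
    forall A, measurable A -> Q A = 0%E <-> V A = 0%E].
Proof.
move=> ergV; have [Q cQ QS] := invariant_core; exists Q; split=> // A mA.
have [_ _ _ QV] := cQ.
have QV0 B : measurable B -> V B = 0%E -> Q B = 0%E.
  by move=> mB VB; apply/eqP; rewrite eq_le measure_ge0 -VB QV.
split; last exact: QV0.
move=> QA; have mL := measurable_inf_often mS mA.
have QI n : Q (iter n S @^-1` A) = 0%E by rewrite (cap_invariant_iter mS QS).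
have QL : Q (inf_often S A) = 0%E.
  apply: (@prob_null_sub _ _ _ Q _ (\bigcup_n (iter n S @^-1` A))) => //.
  - by apply: bigcupT_measurable => n; exact: measurable_iter_preimage.
  - by move=> x /(_ 0%N I)[n _ An]; exists n.
  - by apply: prob_null_bigcup => // n; exact: measurable_iter_preimage.
have VL : V (inf_often S A) = 0%E.
  have [//|VC] := ergV _ mL (inf_often_invariant S A).
  by case: (prob_null_setC mL QL (QV0 _ (measurableC mL) VC)).
apply/eqP; rewrite eq_le upper_ge0// andbT -VL.
have mU N : measurable (\bigcup_(n in [set n | (N <= n)%N]) (iter n S @^-1` A)).
  by apply: bigcup_measurable => n _; exact: measurable_iter_preimage.
(* Each tail union contains the preimage of [A] under the [N]-th iterate, whose [V]-value is
   [V A]. *)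
apply: upper_bigcap => //.
- move=> N M NM; apply/subsetPset => x [n /= Mn An]; exists n => //=.
  exact: leq_trans Mn.
- move=> N; rewrite -(cap_invariant_iter mS VS N mA).
  have [[_ _ Vmono] _] := upV; apply: Vmono => //.
    exact: measurable_iter_preimage.
  by move=> x Ax; exists N => /=.
Qed.

End InvariantCore.

(** * Null sets of products *)

Section ProductNull.
Context {R : realType} {d d' : measure_display} {T : measurableType d}
  {T' : measurableType d'}.

Lemma prod_null_section (Q : probability T R) (Q' : probability T' R) B :
  measurable B -> (Q \x Q')%E B = 0%E ->
  exists N, [/\ measurable N, Q N = 0%E &
    forall x, ~ N x -> Q' (xsection B x) = 0%E].
Proof.
move=> mB B0; pose g x := Q' (xsection B x).
have mg : measurable_fun setT g by exact: measurable_fun_xsection.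
have g0 : (\int[Q]_x `|g x| = 0)%E.
  by rewrite -B0; apply: eq_integral => x _; rewrite gee0_abs.
have mN : measurable [set x | g x != 0%E].
  rewrite -[X in measurable X]setTI; exact: emeasurable_neq.
exists [set x | g x != 0%E]; split=> //; last first.
  by move=> x /= /negP; rewrite negbK => /eqP.
apply: (negligibleP Q mN).1.
have [N [mN' N0 gN]] := (ae_eq_integral_abs Q measurableT mg).1 g0.
exists N; split=> // x /= /eqP gx; apply: gN => /= h; apply: gx; exact: h.
Qed.

Lemma prod_null_dominated (Q P : probability T R) (Q' P' : probability T' R) B :
  (forall A, measurable A -> Q A = 0%E -> P A = 0%E) ->
  (forall A, measurable A -> Q' A = 0%E -> P' A = 0%E) ->
  measurable B -> (Q \x Q')%E B = 0%E -> (P \x P')%E B = 0%E.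
Proof.
move=> QP QP' mB B0; have [N [mN N0 NB]] := prod_null_section mB B0.
have mg : measurable_fun setT (fun x => P' (xsection B x)).
  exact: measurable_fun_xsection.
transitivity (\int[P]_x `|P' (xsection B x)|)%E.
  by apply: eq_integral => x _; rewrite gee0_abs.
apply: (ae_eq_integral_abs P measurableT mg).2.
exists N; split=> //; first exact: QP.
move=> x /= h; apply: contrapT => Nx; apply: h => _.
by apply: QP'; [exact: measurable_xsection|exact: NB].
Qed.

Variables (V : set T -> \bar R) (V' : set T' -> \bar R).

Lemma prod_upper_ge (P : probability T R) (P' : probability T' R) B :
  core V P -> core V' P' -> ((P \x P') B <= prod_upper V V' B)%E.
Proof. by move=> cP cP'; apply: ereal_sup_ubound; exists P, P'. Qed.

(** All core measures are absolutely continuous with respect to [Q] and [Q'], hence so are their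
    products with respect to the product of [Q] and [Q']. *)
Lemma prod_upper_null (Q : probability T R) (Q' : probability T' R) B :
  core V Q -> core V' Q' ->
  (forall A, measurable A -> Q A = 0%E <-> V A = 0%E) ->
  (forall A, measurable A -> Q' A = 0%E <-> V' A = 0%E) ->
  measurable B -> prod_upper V V' B = 0%E <-> (Q \x Q')%E B = 0%E.
Proof.
move=> cQ cQ' QV QV' mB; split=> [B0|B0].
  by apply/eqP; rewrite eq_le measure_ge0 andbT -B0 prod_upper_ge.
apply/eqP; rewrite eq_le -{2}B0 prod_upper_ge// andbT.
apply: ge_ereal_sup => _ [P [P' [[_ P0 _ PV] [_ P0' _ PV'] ->]]].
rewrite (@prod_null_dominated Q P Q' P')//.
- by move=> A mA /(QV A mA) VA; apply/eqP; rewrite eq_le measure_ge0 andbT -VA PV.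
- by move=> A mA /(QV' A mA) VA; apply/eqP; rewrite eq_le measure_ge0 andbT -VA PV'.
Qed.

Variables (S : T -> T) (S' : T' -> T').

(** If the complement of [B] is null, each product of core measures gives [B] mass 1; as both cores
    contain a probability, the supremum is 1. *)
Lemma prod_upper_ergodic : upper_probability V -> upper_probability V' ->
  null_ergodic (prod_map S S') (prod_upper V V') ->
  cap_ergodic (prod_map S S') (prod_upper V V').
Proof.
move=> upV upV' erg B mB BS; have h := erg B mB BS; split=> //.
case: h => [|BC0]; [by left|right].
have all1 (P : probability T R) (P' : probability T' R) :
    core V P -> core V' P' -> (P \x P')%E B = 1%E.
  move=> cP cP'; have : ((P \x P') (~` B) = 0)%E.
    by apply/eqP; rewrite eq_le measure_ge0 andbT -BC0 prod_upper_ge.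
  exact: (prob_eq1 (P := (P \x P')%E)).
have [P cP] := upper_core upV; have [P' cP'] := upper_core upV'.
apply/eqP; rewrite eq_le; apply/andP; split; last by rewrite -(all1 P P') ?prod_upper_ge.
by apply: ge_ereal_sup => _ [P1 [P2 [cP1 cP2 ->]]]; rewrite all1.
Qed.

(** Test the product on the cylinder over an invariant set. *)
Lemma ergodic_of_prod : upper_probability V -> upper_probability V' ->
  cap_ergodic (prod_map S S') (prod_upper V V') -> null_ergodic S V.
Proof.
move=> upV upV' erg B mB BS; have [P' cP'] := upper_core upV'.
have V0 A : measurable A -> prod_upper V V' (A `*` setT) = 0%E -> V A = 0%E.
  move=> mA A0; have [P cP ->] := upper_coreP upV mA.
  have : ((P \x P') (A `*` setT) <= 0)%E by rewrite -A0 prod_upper_ge.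
  rewrite product_measure1E// [X in (_ * X)%E]probability_setT mule1 => PA.
  by apply/eqP; rewrite eq_le PA measure_ge0.
have [||_ [/V0|]] := erg (B `*` setT).
- exact: measurableX.
- have BSx x : B (S x) = B x by exact: (congr1 (fun A => A x) BS).
  by apply/seteqP; split=> -[x y] /= []; rewrite /= BSx.
- by move=> /(_ mB); left.
- move=> BC0; right; apply: V0; first exact: measurableC.
  rewrite -BC0; congr prod_upper; apply/seteqP; split=> -[x y] /=.
    by move=> [Bx _] [].
  by move=> h; split=> // Bx; apply: h.
Qed.

End ProductNull.

(** * Eigenfunctions from ergodicity of the square *)

Section EigenfunctionConstant.
Context {R : realType} {d : measure_display} {T : measurableType d}.
Variables (Q : probability T R) (S : T -> T).
Hypotheses (mS : measurable_fun setT S) (QS : cap_invariant S Q).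
Hypothesis erg : null_ergodic (prod_map S S) (Q \x Q)%E.

Lemma measurable_prod_map : measurable_fun setT (prod_map S S).
Proof.
apply: measurable_fun_pair.
  exact: (measurableT_comp mS measurable_fst).
exact: (measurableT_comp mS measurable_snd).
Qed.

Lemma iter_prod_map n x y : iter n (prod_map S S) (x, y) = (iter n S x, iter n S y).
Proof. by elim: n => //= n ->. Qed.

(** A superlevel set of [h] is invariant only within [E] times [E]. Replacing it by its [inf_often]
    makes it strictly invariant and changes it only on a null set. *)
Lemma prod_ae_cst (E : set T) (h : T * T -> R) :
  measurable E -> Q (~` E) = 0%E -> (forall x, E x -> E (S x)) ->
  measurable_fun setT h ->
  (forall x y, E x -> E y -> h (S x, S y) = h (x, y)) ->
  exists c, (Q \x Q)%E [set z | h z != c] = 0%E.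
Proof.
move=> mE E0 ES mh hS; apply: (@ae_cst_of_01 _ _ _ (Q \x Q)%E h mh) => t.
set A := [set z | t < h z].
have mA : measurable A by exact: measurable_superlevel.
have mEC : measurable (~` E) by exact: measurableC.
pose D := (~` E `*` setT) `|` (setT `*` ~` E) : set (T * T).
have mD1 : measurable (~` E `*` setT : set (T * T)) by exact: measurableX.
have mD2 : measurable (setT `*` ~` E : set (T * T)) by exact: measurableX.
have mD : measurable D by exact: measurableU.
have D0 : (Q \x Q)%E D = 0%E.
  have D1 : ((Q \x Q) (~` E `*` setT) = 0)%E.
    by rewrite product_measure1E// [X in (X * _)%E]E0 mul0e.
  have D2 : ((Q \x Q) (setT `*` ~` E) = 0)%E.
    by rewrite product_measure1E// [X in (_ * X)%E]E0 mule0.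
  exact: (@prob_null_setU _ _ _ (Q \x Q)%E).
pose L := inf_often (prod_map S S) A.
have mL : measurable L := measurable_inf_often measurable_prod_map mA.
have iterh n x y : E x -> E y -> h (iter n (prod_map S S) (x, y)) = h (x, y).
  move=> Ex Ey; rewrite iter_prod_map.
  elim: n x y Ex Ey => // n IH x y Ex Ey.
  by rewrite !iterSr IH ?hS//; exact: ES.
have LA x y : E x -> E y -> L (x, y) <-> A (x, y).
  move=> Ex Ey; split=> [/(_ 0%N I)[n _]|Axy N _].
    by rewrite /preimage /= /A /= iterh.
  by exists N => //=; rewrite /preimage /A /= iterh.
have inD x y : ~ D (x, y) -> E x /\ E y.
  move=> nD; split; apply: contrapT => nE; apply: nD; [by left|by right].
have [L0|L0] := erg mL (inf_often_invariant _ A); [left|right].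
- apply: (@prob_null_sub _ _ _ (Q \x Q)%E _ (L `|` D)) => //; first exact: measurableU.
    move=> [x y] Axy; have [Dxy|/inD[Ex Ey]] := pselect (D (x, y)); first by right.
    by left; exact/(LA x y Ex Ey).
  exact: (@prob_null_setU _ _ _ (Q \x Q)%E).
- apply: (@prob_null_sub _ _ _ (Q \x Q)%E _ (~` L `|` D)).
  + exact: measurableC.
  + by apply: measurableU => //; exact: measurableC.
  + move=> [x y] Axy; have [Dxy|/inD[Ex Ey]] := pselect (D (x, y)); first by right.
    by left=> /(LA x y Ex Ey).
  by apply: (@prob_null_setU _ _ _ (Q \x Q)%E) => //; exact: measurableC.
Qed.

Lemma cmeasurable_neq (f : T -> R[i]) c : cmeasurable f -> measurable [set x | f x != c].
Proof.
move=> [mRe mIm].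
rewrite (_ : [set x | _] = [set x | complex.Re (f x) != complex.Re c] `|`
   [set x | complex.Im (f x) != complex.Im c]).
  by apply: measurableU; exact: measurable_neq.
apply/seteqP; split=> x /=; rewrite eq_complex negb_and.
  by move=> /orP.
by move=> h; apply/orP.
Qed.

Lemma measurable_sqnorm_inv (f : T -> R[i]) : cmeasurable f ->
  measurable_fun setT (fun x => (complex.Re (f x) ^+ 2 + complex.Im (f x) ^+ 2)^-1).
Proof.
move=> [mRe mIm].
have -> : (fun x => (complex.Re (f x) ^+ 2 + complex.Im (f x) ^+ 2)^-1) =
    (fun x => (complex.Re (f x) ^+ 2 + complex.Im (f x) ^+ 2) `^ (- 1)).
  by apply/funext => x; rewrite powR_inv1// addr_ge0// sqr_ge0.
apply: (measurableT_comp (measurable_powR _)).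
by apply: measurable_funD; exact: measurable_funX.
Qed.

Lemma cdivE (z w : R[i]) : let n := (complex.Re w ^+ 2 + complex.Im w ^+ 2)^-1 in
  complex.Re (z / w) = (complex.Re z * complex.Re w + complex.Im z * complex.Im w) * n /\
  complex.Im (z / w) = (complex.Im z * complex.Re w - complex.Re z * complex.Im w) * n.
Proof. by case: z => a b; case: w => a' b' /=; split; ring. Qed.

(* [f y / f x] is invariant under the product map, hence constant, and its
   section at a point [x] with [f x != 0] exhibits [f] as constant. *)
Lemma eigenfunction_cst (f : T -> R[i]) (lam : R[i]) N : cmeasurable f ->
  measurable N -> Q N = 0%E -> (forall x, ~ N x -> f (S x) = lam * f x) ->
  exists c, Q [set x | f x != c] = 0%E.
Proof.
move=> mf mN N0 fS; have [mRe mIm] := mf.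
(* For [lam = 0] the preimage under [S] of the set where [f] is nonzero lies in [N], so that set is
   null by invariance. *)
have [lam0|lam0] := eqVneq lam 0.
  have mZ := cmeasurable_neq 0 mf.
  exists 0; rewrite -(QS mZ); apply: prob_null_sub N0 => //.
    exact: (measurable_iter_preimage mS 1 mZ).
  by move=> x /= fx; apply: contrapT => /fS fSx; move: fx; rewrite fSx lam0 mul0r eqxx.
(* The points whose orbit never meets [N]: a forward invariant set of full measure. *)
pose E := ~` \bigcup_n (iter n S @^-1` N).
have mU : measurable (\bigcup_n (iter n S @^-1` N)).
  by apply: bigcupT_measurable => n; exact: measurable_iter_preimage.
have mE : measurable E by exact: measurableC.
have E0 : Q (~` E) = 0%E.
  rewrite setCK; apply: prob_null_bigcup => n; first exact: measurable_iter_preimage.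
  by rewrite (cap_invariant_iter mS QS).
have ES x : E x -> E (S x).
  by move=> Ex [n _ Nn]; apply: Ex; exists n.+1 => //; rewrite /preimage /= -iterS iterSr.
have fE x : E x -> f (S x) = lam * f x.
  by move=> Ex; apply: fS => Nx; apply: Ex; exists 0%N.
(* With the convention that division by zero gives 0, invariance also holds where [f z.1]
   vanishes. *)
pose g (z : T * T) := f z.2 / f z.1.
have gS x y : E x -> E y -> g (S x, S y) = g (x, y).
  by move=> Ex Ey; rewrite /g /= !fE// -mulf_div divff ?mul1r.
have mRe1 := measurableT_comp mRe (@measurable_fst _ _ T T).
have mRe2 := measurableT_comp mRe (@measurable_snd _ _ T T).
have mIm1 := measurableT_comp mIm (@measurable_fst _ _ T T).
have mIm2 := measurableT_comp mIm (@measurable_snd _ _ T T).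
have mn := measurableT_comp (measurable_sqnorm_inv mf) (@measurable_fst _ _ T T).
have mg1 : measurable_fun setT (fun z => complex.Re (g z)).
  under eq_fun do rewrite /g (cdivE _ _).1.
  by apply: measurable_funM => //; apply: measurable_funD; exact: measurable_funM.
have mg2 : measurable_fun setT (fun z => complex.Im (g z)).
  under eq_fun do rewrite /g (cdivE _ _).2.
  by apply: measurable_funM => //; apply: measurable_funB; exact: measurable_funM.
have [c1 Hc1] := prod_ae_cst mE E0 ES mg1 (fun x y Ex Ey => congr1 _ (gS x y Ex Ey)).
have [c2 Hc2] := prod_ae_cst mE E0 ES mg2 (fun x y Ex Ey => congr1 _ (gS x y Ex Ey)).
set M1 := [set z | _] in Hc1; set M2 := [set z | _] in Hc2.
have mM1 : measurable M1 by exact: measurable_neq.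
have mM2 : measurable M2 by exact: measurable_neq.
have M0 : (Q \x Q)%E (M1 `|` M2) = 0%E by exact: (@prob_null_setU _ _ _ (Q \x Q)%E).
have mM : measurable (M1 `|` M2) by exact: measurableU.
have [N' [mN' N'0 secN']] := prod_null_section mM M0.
have [Z0|Z0] := pselect (Q [set x | f x != 0] = 0%E); first by exists 0.
have [x fx N'x] : exists2 x, f x != 0 & ~ N' x.
  apply: contrapT => h; apply: Z0; apply: prob_null_sub N'0 => //.
    exact: cmeasurable_neq.
  by move=> x /= fx; apply: contrapT => N'x; apply: h; exists x.
exists ((c1 +i* c2)%C * f x); apply: prob_null_sub (secN' x N'x).
- exact: cmeasurable_neq.
- exact: measurable_xsection.
move=> y /= fy; rewrite /xsection /= inE; apply: contrapT => /not_orP[/negP].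
rewrite negbK => /eqP r1 /negP; rewrite negbK => /eqP r2.
move: fy; rewrite -(divfK fx (f y)); apply/negP; rewrite negbK; apply/eqP; congr (_ * _).
by apply/eqP; rewrite eq_complex /=; move: r1 r2; rewrite /g /= => -> ->; rewrite !eqxx.
Qed.

End EigenfunctionConstant.

(** * Weak mixing, one-point systems and the equivalence *)

Section WeaklyMixing.
Context {R : realType} {d : measure_display} {T : measurableType d}.
Variables (V : set T -> \bar R) (S : T -> T).
Hypothesis upV : upper_probability V.

(** The indicator of an invariant set is an eigenfunction for the eigenvalue 1. If its almost sure
    value is 1, the complement lies in the exceptional set; otherwise the set itself does. *)
Lemma weakly_mixing_ergodic : weakly_mixing S V -> null_ergodic S V.
Proof.
move=> wm B mB BS; pose f x : R[i] := (\1_B x)%:C%C.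
have mf : cmeasurable f.
  by split; [exact: measurable_indic|exact: measurable_cst].
have V0 : V set0 = 0%E by case: upV => -[].
have [|c [N [mN N0 fN]]] := wm f 1 mf.
  exists set0; split=> // x; apply; rewrite mul1r /f !indicE; congr ((_%:R)%:C)%C.
  by congr nat_of_bool; apply/asbool_equiv_eq; rewrite -{2}BS.
have Vsub A : measurable A -> A `<=` N -> V A = 0%E.
  move=> mA AN; apply/eqP; rewrite eq_le upper_ge0// andbT -N0.
  by case: upV => -[_ _ Vmono] _; exact: Vmono.
have [c1|/eqP c1] := eqVneq c 1; [right|left]; apply: Vsub => //.
- exact: measurableC.
- move=> x nBx; apply: fN; rewrite /f indicE memNset//= c1 => /eqP.
  by rewrite eq_sym oner_eq0.
- by move=> x Bx; apply: fN; rewrite /f indicE mem_set//= => h; apply: c1.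
Qed.

End WeaklyMixing.

(** On a one-point space this provides a trivial ergodic factor, used to read ergodicity of [V] off
    condition (ii). *)
Lemma dirac_upper {R : realType} {d} {T : measurableType d} (a : T) :
  upper_probability (\d_a : set T -> \bar R).
Proof.
split.
  split; [exact: measure0|exact: probability_setT|].
  by move=> A B mA mB AB; apply: le_measure; rewrite ?inE.
exists [set (\d_a : probability T R)]; split.
  by rewrite /setwise_compact image_set1; exact: compact_set1.
by move=> A mA; split; [exists (\d_a : probability T R)|move=> _ ->].
Qed.

Lemma dirac_ergodic {R : realType} {d} {T : measurableType d} (a : T) (S : T -> T) :
  cap_ergodic S (\d_a : set T -> \bar R).
Proof.
move=> B mB _; rewrite !diracE in_setC; case: (_ \in _) => /=.
  by split; right.
by split; left.
Qed.

Theorem theorem5p6 (d : measure_display) (T : measurableType d) (R : realType)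
  (S : T -> T) (V : set T -> \bar R) :
  measurable_fun setT S ->
  upper_probability V ->
  cap_invariant S V ->
  (weakly_mixing S V <->
   (forall (d' : measure_display) (T' : measurableType d') (S' : T' -> T')
      (V' : set T' -> \bar R),
      measurable_fun setT S' -> upper_probability V' -> cap_invariant S' V' ->
      cap_ergodic S' V' ->
      cap_ergodic (prod_map S S') (prod_upper V V'))) /\
  (weakly_mixing S V <-> cap_ergodic (prod_map S S) (prod_upper V V)).
Proof.
move=> mS upV VS.
have capn (d' : measure_display) (T' : measurableType d') (S' : T' -> T')
    (V' : set T' -> \bar R) : cap_ergodic S' V' -> null_ergodic S' V'.
  by move=> erg B mB BS; exact: (erg B mB BS).2.
(* Stated with [null_ergodic], so that it also applies to [V] itself through [weakly_mixing_ergodic]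
   and gives (iii). *)
have i_ii : weakly_mixing S V -> forall (d' : measure_display)
    (T' : measurableType d') (S' : T' -> T') (V' : set T' -> \bar R),
    measurable_fun setT S' -> upper_probability V' -> cap_invariant S' V' ->
    null_ergodic S' V' -> cap_ergodic (prod_map S S') (prod_upper V V').
  move=> wm d' T' S' V' mS' upV' VS' ergV'.
  have [Q [cQ QS QV]] := ergodic_core upV mS VS (weakly_mixing_ergodic upV wm).
  have [Q' [cQ' QS' QV']] := ergodic_core upV' mS' VS' ergV'.
  apply: prod_upper_ergodic => // B mB BS.
  have mBC : measurable (~` B) by exact: measurableC.
  have ergQ' : null_ergodic S' Q'.
    move=> A mA AS; have mAC : measurable (~` A) by exact: measurableC.
    by have [/(QV' A mA)|/(QV' _ mAC)] := ergV' A mA AS; [left|right].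
  have noeig (f : T -> R[i]) (lam : R[i]) : cmeasurable f ->
      (forall x, f (S x) = lam * f x) -> exists c, mu_as Q (fun x => f x = c).
    move=> mf fS; have [|c [N [mN N0 fN]]] := wm f lam mf.
      by exists set0; split=> //; case: upV => -[].
    by exists c, N; split=> //; exact/(QV N mN).
  have [B0|B0] := noeig_prod_ergodic mS mS' QS QS' ergQ' noeig mB BS; [left|right].
    exact/(prod_upper_null cQ cQ' QV QV' mB).
  exact/(prod_upper_null cQ cQ' QV QV' mBC).
have iii_i : cap_ergodic (prod_map S S) (prod_upper V V) -> weakly_mixing S V.
  move=> erg; have ergV := ergodic_of_prod upV upV erg.
  have [Q [cQ QS QV]] := ergodic_core upV mS VS ergV.
  have ergQQ : null_ergodic (prod_map S S) (Q \x Q)%E.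
    move=> B mB BS; have mBC : measurable (~` B) by exact: measurableC.
    have [_ [/(prod_upper_null cQ cQ QV QV mB)|/(prod_upper_null cQ cQ QV QV mBC)]] :=
      erg B mB BS; by [left|right].
  move=> f lam mf [N [mN N0 fN]].
  have [c c0] := @eigenfunction_cst _ _ _ Q S mS QS ergQQ f lam N mf mN
    ((QV N mN).2 N0) (fun x Nx => contrapT (fun h => Nx (fN x h))).
  have mc := cmeasurable_neq c mf.
  exists c, [set x | f x != c]; split=> //; first exact/(QV _ mc).
  by move=> x /eqP.
split; split; [|move=> ii|move=> wm|exact: iii_i].
- by move=> wm d' T' S' V' mS' upV' VS' /capn; exact: i_ii.
- apply: iii_i.
  (* Condition (ii) is used twice: with the one-point system, to get ergodicity of [V], and then
     with [V] itself. *)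
  have ergV : null_ergodic S V.
    apply: (@ergodic_of_prod _ _ _ _ _ V (\d_tt) S id upV (dirac_upper tt)).
    apply: ii; [exact: measurable_id|exact: dirac_upper|by move=> A|exact: dirac_ergodic].
  apply: ii => // B mB BS; have [VB|VB] := ergV B mB BS.
    by split; left.
  split; right=> //.
  (* A core measure attaining [V B] gives the complement mass 0, so [V B] is 1. *)
  have [P [_ _ _ PV] ->] := upper_coreP upV mB.
  have mBC : measurable (~` B) by exact: measurableC.
  have PC : P (~` B) = 0%E by apply/eqP; rewrite eq_le measure_ge0 andbT -VB PV.
  exact: prob_eq1.
- by apply: i_ii => //; exact: weakly_mixing_ergodic.
Qed.
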